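(* Let $X$ be a real Banach space with $\dim(X)\ge 2$. Then $F^{ph}(X)$ contains a closed subspace linearly isomorphic (as a Banach space) to $L^1(\mathbb{R})$, and therefore $Lip_0^{ph}(X)$ is infinite-dimensional.
   Context: $Lip_0^{ph}(X)$ is the Banach space of all Lipschitz functions $f:X\to\mathbb{R}$ with $f(\alpha x)=\alpha f(x)$ for all $\alpha\ge0$, $x\in X$, with norm $Lip(f)=\sup_{x\neq y}\frac{|f(x)-f(y)|}{\|x-y\|}$. For $x\in X$, $\delta_x^{ph}\in Lip_0^{ph}(X)^*$ is the evaluation functional $\delta_x^{ph}(f)=f(x)$, and $F^{ph}(X)=\overline{\operatorname{span}}^{\|\cdot\|}\{\delta_x^{ph}:x\in X\}\subset Lip_0^{ph}(X)^*$. *)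

(* Defs.v *)
From HB Require Import structures.
From mathcomp Require Import all_boot all_order all_algebra.
From mathcomp Require Import all_classical all_reals all_analysis.
From mathcomp Require Import measurable_realfun.

Set Implicit Arguments.
Unset Strict Implicit.
Unset Printing Implicit Defensive.
Import Order.TTheory GRing.Theory Num.Theory.
Import numFieldNormedType.Exports.

Local Open Scope classical_set_scope.
Local Open Scope ring_scope.

Section sup_image.
Context {R : realType} {I : Type}.
Implicit Types (P : set I) (h : I -> R) (M : R).

Lemma sup_image_le P h M : 0 <= M -> (forall i, P i -> h i <= M) ->
  sup (h @` P) <= M.
Proof.
move=> M0 hM; have [->|/set0P P0] := eqVneq (h @` P) set0; first by rewrite sup0.
by apply: ge_sup => // _ [i Pi <-]; exact: hM.
Qed.

Lemma le_sup_image P h M i : (forall i, P i -> h i <= M) -> P i ->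
  h i <= sup (h @` P).
Proof.
move=> hM Pi; apply: sup_ubound; last by exists i.
by exists M => _ [j Pj <-]; exact: hM.
Qed.

Lemma sup_image_ge0 P h M : (forall i, P i -> 0 <= h i <= M) ->
  0 <= sup (h @` P).
Proof.
move=> hM; have [->|/set0P[_ [i Pi _]]] := eqVneq (h @` P) set0.
  by rewrite sup0.
apply: le_trans (le_sup_image (M := M) (i := i) _ Pi).
  by case/andP: (hM _ Pi).
by move=> j /hM /andP[].
Qed.

End sup_image.

Section lip0ph.
Context {R : realType} (X : normedModType R).

Definition pos_homogeneous (f : X -> R) :=
  forall (a : R) (x : X), 0 <= a -> f (a *: x) = a * f x.

Definition lip0ph_pred : {pred X -> R} :=
  mem [set f : X -> R | lipschitz f /\ pos_homogeneous f].

Record Lip0ph := MkLip0ph {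
  lip0ph_fun :> X -> R;
  _ : lip0ph_fun \in lip0ph_pred }.

HB.instance Definition _ := [isSub for lip0ph_fun].
HB.instance Definition _ := [Choice of Lip0ph by <:].

Lemma lipschitz_bound (f : X -> R) : lipschitz f <->
  exists M : R, forall x y, `|f x - f y| <= M * `|x - y|.
Proof.
have PF : ProperFilter (globally ([set: X] `*` [set: X])).
  exact: (@globally_properfilter _ _ (0, 0)).
rewrite /lipschitz_on ex_dom_bound; split=> -[M fM].
  by exists M => x y; exact: (fM (x, y)).
by exists M => -[x y] _; exact: fM.
Qed.

Lemma lip0ph_submod_closed : submod_closed lip0ph_pred.
Proof.
split=> [|a f g].
  rewrite inE/=; split.
    by apply/lipschitz_bound; exists 0 => x y; rewrite subrr normr0 mul0r.
  by move=> a x _; rewrite /= mulr0.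
rewrite !inE/= => -[/lipschitz_bound[M fM] hf] [/lipschitz_bound[N gN] hg].
split; last first.
  move=> b x b0; rewrite !fctE/= hf// hg//.
  by rewrite mulrDr /GRing.scale/= mulrCA.
apply/lipschitz_bound; exists (`|a| * M + N) => x y.
rewrite !fctE/= opprD addrACA -scalerBr mulrDl.
rewrite (le_trans (ler_normD _ _))// lerD// normrM -mulrA.
by rewrite ler_wpM2l.
Qed.

HB.instance Definition _ := GRing.isSubmodClosed.Build _ _ lip0ph_pred
  lip0ph_submod_closed.
HB.instance Definition _ := [SubChoice_isSubLmodule of Lip0ph by <:].

(* When X = {0} the set below is empty and its sup is 0 by convention. *)
Definition lip_norm (f : Lip0ph) : R :=
  sup [set `|f xy.1 - f xy.2| / `|xy.1 - xy.2| |
       xy in [set xy : X * X | xy.1 != xy.2]].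

Implicit Types f g : Lip0ph.

Lemma lip0phP (f : Lip0ph) : lipschitz f /\ pos_homogeneous f.
Proof. by have := valP f; rewrite inE. Qed.

Lemma lip0ph0 (f : Lip0ph) : f 0 = 0.
Proof. by have [_ /(_ 0 0 (lexx _))] := lip0phP f; rewrite scale0r mul0r. Qed.

Lemma lip_quot_le (f : Lip0ph) (M : R) :
  (forall x y, `|f x - f y| <= M * `|x - y|) ->
  forall xy : X * X, xy.1 != xy.2 ->
    0 <= `|f xy.1 - f xy.2| / `|xy.1 - xy.2| <= M.
Proof.
move=> fM [x y]/= xy; rewrite divr_ge0//= ler_pdivrMr ?fM//.
by rewrite normr_gt0 subr_eq0.
Qed.

Lemma lip_norm_ge0 f : 0 <= lip_norm f.
Proof.
have [/lipschitz_bound[M fM] _] := lip0phP f.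
exact: (sup_image_ge0 (lip_quot_le fM)).
Qed.

Lemma lip_normP f x y : `|f x - f y| <= lip_norm f * `|x - y|.
Proof.
have [/lipschitz_bound[M fM] _] := lip0phP f.
have [->|xy] := eqVneq x y; first by rewrite !subrr !normr0 mulr0.
rewrite -ler_pdivrMr ?normr_gt0 ?subr_eq0//.
apply: (le_sup_image (i := (x, y)) (M := M)
  (h := fun xy : X * X => `|f xy.1 - f xy.2| / `|xy.1 - xy.2|)) => // i Pi.
by case/andP: (lip_quot_le fM Pi).
Qed.

Lemma lip_norm_le f M : 0 <= M ->
  (forall x y, `|f x - f y| <= M * `|x - y|) -> lip_norm f <= M.
Proof.
move=> M0 fM; apply: sup_image_le => // i Pi.
by case/andP: (lip_quot_le fM Pi).
Qed.

Lemma lip_normD f g : lip_norm (f + g) <= lip_norm f + lip_norm g.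
Proof.
apply: lip_norm_le => [|x y]; first by rewrite addr_ge0// lip_norm_ge0.
rewrite [(f + g) _]/(f x + g x) [(f + g) _]/(f y + g y).
rewrite opprD addrACA mulrDl (le_trans (ler_normD _ _))//.
by rewrite lerD// lip_normP.
Qed.

Lemma lip_normZ_le (a : R) f : lip_norm (a *: f) <= `|a| * lip_norm f.
Proof.
apply: lip_norm_le => [|x y]; first by rewrite mulr_ge0// lip_norm_ge0.
rewrite [(a *: f) _]/(a * f x) [(a *: f) _]/(a * f y).
by rewrite -mulrBr normrM -mulrA ler_wpM2l// lip_normP.
Qed.

Lemma lip_normZ (a : R) f : lip_norm (a *: f) = `|a| * lip_norm f.
Proof.
apply/eqP; rewrite eq_le lip_normZ_le/=.
have [->|a0] := eqVneq a 0; first by rewrite normr0 mul0r lip_norm_ge0.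
rewrite -{1}[f](scalerK a0) -ler_pdivlMl ?normr_gt0// -normfV.
exact: lip_normZ_le.
Qed.

Lemma lip_norm0_eq0 f : lip_norm f = 0 -> f = 0.
Proof.
move=> f0; apply/val_inj/funext => x /=.
have := lip_normP f x 0; rewrite f0 mul0r lip0ph0 subr0 normr_le0.
by move=> /eqP.
Qed.

HB.instance Definition _ := Lmodule_isNormed.Build R Lip0ph
  lip_normD lip_normZ lip_norm0_eq0.

End lip0ph.

Section dual.
Context {R : realType} (V : normedModType R).

Definition dual_pred : {pred V -> R} :=
  mem [set f : V -> R | linear f /\ continuous f].

Record dual := MkDual {
  dual_fun :> V -> R;
  _ : dual_fun \in dual_pred }.

HB.instance Definition _ := [isSub for dual_fun].
HB.instance Definition _ := [Choice of dual by <:].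

Lemma dual_submod_closed : submod_closed dual_pred.
Proof.
split=> [|a f g].
  rewrite inE/=; split; last by move=> x; exact: cvg_cst.
  by move=> a x y; rewrite /= scaler0 addr0.
rewrite !inE/= => -[lf cf] [lg cg]; split.
  move=> b x y; rewrite !fctE/= lf lg scalerDr addrACA; congr (_ + _).
  by rewrite scalerDr !scalerA mulrC.
move=> x; apply: (@cvgD _ _ _ _ _ (a *: f) g); last exact: cg.
by apply: cvgZr; exact: cf.
Qed.

HB.instance Definition _ := GRing.isSubmodClosed.Build _ _ dual_pred
  dual_submod_closed.
HB.instance Definition _ := [SubChoice_isSubLmodule of dual by <:].

Definition dual_norm (f : dual) : R :=
  sup [set `|f v| | v in [set v : V | `|v| <= 1]].

Implicit Types f g : dual.

Lemma dual_continuous (f : dual) : continuous (f : V -> R).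
Proof. by have := valP f; rewrite inE => -[]. Qed.

Lemma dual_linear (f : dual) : linear (f : V -> R).
Proof. by have := valP f; rewrite inE => -[]. Qed.

HB.instance Definition _ (f : dual) :=
  GRing.isLinear.Build R V R _ (f : V -> R) (@dual_linear f).

Lemma dual_bound (f : dual) : exists M : R, forall v, `|f v| <= M * `|v|.
Proof.
have /linear_bounded_continuous/linear_boundedP := @dual_continuous f.
by move=> /pinfty_ex_gt0[M M0 fM]; exists M.
Qed.

Lemma dual_norm_ge0 f : 0 <= dual_norm f.
Proof.
have [M fM] := dual_bound f.
apply: (@sup_image_ge0 _ _ _ _ `|M|) => v /= v1; rewrite normr_ge0/=.
rewrite (le_trans (fM v))// (le_trans (ler_norm _))// normrM normr_id.
by rewrite ler_piMr.
Qed.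

Lemma dual_normP f v : `|f v| <= dual_norm f * `|v|.
Proof.
have [->|v0] := eqVneq v 0; first by rewrite linear0 !normr0 mulr0.
have nv : 0 < `|v| by rewrite normr_gt0.
rewrite -ler_pdivrMr//.
have -> : `|f v| / `|v| = `|f (`|v|^-1 *: v)|.
  by rewrite linearZ/= normrM normfV normr_id mulrC.
have [M fM] := dual_bound f.
apply: (@le_sup_image _ _ _ (fun v => `|f v|) `|M|) => [w /= w1|/=].
  rewrite (le_trans (fM w))// (le_trans (ler_norm _))// normrM normr_id.
  by rewrite ler_piMr.
by rewrite normfZV.
Qed.

Lemma dual_norm_le f M : 0 <= M ->
  (forall v, `|f v| <= M * `|v|) -> dual_norm f <= M.
Proof.
move=> M0 fM; apply: sup_image_le => // v /= v1.
by rewrite (le_trans (fM v))// ler_piMr.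
Qed.

Lemma dual_normD f g : dual_norm (f + g) <= dual_norm f + dual_norm g.
Proof.
apply: dual_norm_le => [|v]; first by rewrite addr_ge0// dual_norm_ge0.
rewrite [(f + g) _]/(f v + g v) mulrDl (le_trans (ler_normD _ _))//.
by rewrite lerD// dual_normP.
Qed.

Lemma dual_normZ_le (a : R) f : dual_norm (a *: f) <= `|a| * dual_norm f.
Proof.
apply: dual_norm_le => [|v]; first by rewrite mulr_ge0// dual_norm_ge0.
by rewrite [(a *: f) _]/(a * f v) normrM -mulrA ler_wpM2l// dual_normP.
Qed.

Lemma dual_normZ (a : R) f : dual_norm (a *: f) = `|a| * dual_norm f.
Proof.
apply/eqP; rewrite eq_le dual_normZ_le/=.
have [->|a0] := eqVneq a 0; first by rewrite normr0 mul0r dual_norm_ge0.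
rewrite -{1}[f](scalerK a0) -ler_pdivlMl ?normr_gt0// -normfV.
exact: dual_normZ_le.
Qed.

Lemma dual_norm0_eq0 f : dual_norm f = 0 -> f = 0.
Proof.
move=> f0; apply/val_inj/funext => v /=.
by have := dual_normP f v; rewrite f0 mul0r normr_le0 => /eqP.
Qed.

HB.instance Definition _ := Lmodule_isNormed.Build R dual
  dual_normD dual_normZ dual_norm0_eq0.

End dual.

Section free_space.
Context {R : realType} (X : normedModType R).

Lemma delta_subproof (x : X) :
  (fun f : Lip0ph X => f x) \in @dual_pred R (Lip0ph X).
Proof.
have lin : linear (fun f : Lip0ph X => f x) by [].
rewrite inE/=; split=> //.
pose l := HB.pack_for {linear Lip0ph X -> R} (fun f : Lip0ph X => f x)
  (GRing.isLinear.Build R (Lip0ph X) R _ (fun f : Lip0ph X => f x) lin).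
apply: (@bounded_linear_continuous _ _ _ l); apply/linear_boundedP.
near=> M => f /=; rewrite -[f x]subr0 -(lip0ph0 f).
rewrite (le_trans (lip_normP f x 0))// subr0 mulrC ler_wpM2r ?lip_norm_ge0//.
Unshelve. all: by end_near. Qed.

Definition delta (x : X) : dual (Lip0ph X) := MkDual (delta_subproof x).

Definition linspan (V : lmodType R) (A : set V) : set V :=
  [set v | exists n (c : 'I_n -> R) (a : 'I_n -> V),
    (forall i, A (a i)) /\ v = \sum_i c i *: a i].

Definition Fph : set (dual (Lip0ph X)) := closure (linspan (range delta)).

End free_space.

Arguments delta {R X} x.
Arguments Fph {R} X.

Section L1.
Context d (T : measurableType d) (R : realType).
Variable mu : {measure set T -> \bar R}.

Definition L1 : Type := LspaceType1 mu.

HB.instance Definition _ := gen_eqMixin L1.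
HB.instance Definition _ := gen_choiceMixin L1.

Notation Lfun1 := (LfunType mu (@lexx _ _ 1%E)).
Notation aeEq := {mfun_ mu, T >-> measurableTypeR R}.
Implicit Types (f g h : Lfun1) (u v w : L1).

Lemma L1_repr_subproof (u : L1) :
  (repr (LebesgueSpace.sort u) : T -> R) \in Lfun mu 1%E.
Proof.
case: u => f [[ff]] /=; rewrite inE; apply/andP; split; rewrite inE.
  exact: (@measurable_funPT _ _ _ _ (repr (f : aeEq))).
exact: ff.
Qed.

Definition L1_repr (u : L1) : Lfun1 :=
  Lfun_Sub (@lexx _ _ 1%E) (L1_repr_subproof u).

(* The library has two measurable structures on R with the same measurable sets
   (R itself and measurableTypeR R), distinguished only by their displays. *)
Definition mfun_measurableTypeR (f : T -> R) (mf : measurable_fun setT f) :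
    {mfun T >-> measurableTypeR R} :=
  HB.pack (f : T -> measurableTypeR R)
    (@isMeasurableFun.Build _ _ T (measurableTypeR R) f mf).

Definition L1_pi f : aeEq :=
  (\pi_aeEq (mfun_measurableTypeR (measurable_funPT f)))%qT.

Lemma L1_piE f : (repr (L1_pi f) : T -> R) = f %[ae mu].
Proof.
have : (repr (L1_pi f) =
    mfun_measurableTypeR (measurable_funPT f) %[mod aeEq])%qT.
  by rewrite reprK.
by move=> /eqmodP/asboolP.
Qed.

Lemma measurable_abs_EFin (f : T -> R) : measurable_fun setT f ->
  measurable_fun setT (abse \o (EFin \o f)).
Proof. by move=> mf; apply: measurableT_comp => //; exact/measurable_EFinP. Qed.

Lemma L1_class_subproof f : finite_norm mu 1%E (L1_pi f).
Proof.
have := @Lfunction_finite _ _ _ _ _ _ f; rewrite /finite_norm !Lnorm1.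
congr (_ < _)%E; apply: ae_eq_integral => //.
- exact/measurable_abs_EFin/measurable_funPT.
- apply: measurable_abs_EFin.
  exact: (@measurable_funPT _ _ _ _ (repr (L1_pi f))).
- apply: filterS (L1_piE f) => x /= /(_ I) fx _.
  by congr (`|_|%:E); exact/esym.
Qed.

Definition L1_class f : L1 :=
  LebesgueSpace.Pack (LebesgueSpace.Class
    (isFinLebesgue.Build d T R mu _ (@lexx _ _ 1%E) _ (L1_class_subproof f))).

Lemma L1_classK f : (L1_repr (L1_class f) : T -> R) = f %[ae mu].
Proof. exact: L1_piE. Qed.

Lemma L1_sort_inj (u v : L1) :
  LebesgueSpace.sort u = LebesgueSpace.sort v -> u = v.
Proof.
case: u v => f [[ff]] [g [[gf]]] /= fg; subst g.
by rewrite (Prop_irrelevance ff gf).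
Qed.

Lemma L1_reprK u : L1_class (L1_repr u) = u.
Proof.
apply: L1_sort_inj => /=; rewrite -[RHS]reprK.
by apply/eqmodP/asboolP; apply: nearW.
Qed.

Lemma L1_eqP f g : (f : T -> R) = g %[ae mu] <-> L1_class f = L1_class g.
Proof.
split=> [fg|fg].
  by apply: L1_sort_inj => /=; apply/eqmodP/asboolP.
apply: (ae_eq_trans (ae_eq_sym (L1_classK f))).
by rewrite fg; exact: L1_classK.
Qed.

Lemma L1_surj u : exists f, u = L1_class f.
Proof. by exists (L1_repr u); rewrite L1_reprK. Qed.

(* The library's L^1 type carries no algebraic structure; the operations below
   are those of representatives, and L1_class is the quotient map. *)
Definition L1_add u v : L1 := L1_class (L1_repr u + L1_repr v).
Definition L1_opp u : L1 := L1_class (- L1_repr u).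
Definition L1_scale (a : R) u : L1 := L1_class (a *: L1_repr u).

Lemma L1_class_add f g : L1_add (L1_class f) (L1_class g) = L1_class (f + g).
Proof.
apply/L1_eqP; have := L1_classK f; have := L1_classK g.
by apply: filterS2 => x /= gx fx _; exact: (f_equal2 +%R (fx I) (gx I)).
Qed.

Lemma L1_class_opp f : L1_opp (L1_class f) = L1_class (- f).
Proof.
apply/L1_eqP; have := L1_classK f.
by apply: filterS => x /= fx _; exact: (congr1 -%R (fx I)).
Qed.

Lemma L1_class_scale a f : L1_scale a (L1_class f) = L1_class (a *: f).
Proof.
apply/L1_eqP; have := L1_classK f.
by apply: filterS => x /= fx _; exact: (congr1 ( *%R a) (fx I)).
Qed.

Lemma L1_addA : associative L1_add.
Proof.
move=> u v w; have [f ->] := L1_surj u; have [g ->] := L1_surj v.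
by have [h ->] := L1_surj w; rewrite !L1_class_add addrA.
Qed.

Lemma L1_addC : commutative L1_add.
Proof. by move=> u v; rewrite /L1_add addrC. Qed.

Lemma L1_add0 : left_id (L1_class 0) L1_add.
Proof.
by move=> u; have [f ->] := L1_surj u; rewrite L1_class_add add0r.
Qed.

Lemma L1_addN : left_inverse (L1_class 0) L1_opp L1_add.
Proof.
move=> u; have [f ->] := L1_surj u.
by rewrite L1_class_opp L1_class_add addNr.
Qed.

HB.instance Definition _ := GRing.isZmodule.Build L1
  L1_addA L1_addC L1_add0 L1_addN.

Lemma L1_classD f g : L1_class (f + g) = L1_class f + L1_class g.
Proof. by rewrite -L1_class_add. Qed.

Lemma L1_scaleA a b u : L1_scale a (L1_scale b u) = L1_scale (a * b) u.
Proof.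
by have [f ->] := L1_surj u; rewrite !L1_class_scale scalerA.
Qed.

Lemma L1_scale1 : left_id 1 L1_scale.
Proof.
by move=> u; have [f ->] := L1_surj u; rewrite L1_class_scale scale1r.
Qed.

Lemma L1_scaleDr : right_distributive L1_scale +%R.
Proof.
move=> a u v; have [f ->] := L1_surj u; have [g ->] := L1_surj v.
by rewrite -L1_classD !L1_class_scale scalerDr L1_classD.
Qed.

Lemma L1_scaleDl u : {morph L1_scale^~ u : a b / a + b}.
Proof.
move=> a b; have [f ->] := L1_surj u.
by rewrite !L1_class_scale scalerDl L1_classD.
Qed.

HB.instance Definition _ := GRing.Zmodule_isLmodule.Build R L1
  L1_scaleA L1_scale1 L1_scaleDr L1_scaleDl.

Lemma L1_classZ a f : L1_class (a *: f) = a *: L1_class f.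
Proof. by rewrite -L1_class_scale. Qed.

Definition L1_norm u : R := fine 'N[mu]_1[EFin \o L1_repr u]%E.

Lemma L1_norm_class f : L1_norm (L1_class f) = fine 'N[mu]_1[EFin \o f]%E.
Proof.
rewrite /L1_norm !Lnorm1; congr fine; apply: ae_eq_integral => //.
- exact/measurable_abs_EFin/measurable_funPT.
- exact/measurable_abs_EFin/measurable_funPT.
- apply: filterS (L1_classK f) => x /= /(_ I) fx _.
  by congr (`|_|%:E).
Qed.

Lemma L1_normD u v : L1_norm (u + v) <= L1_norm u + L1_norm v.
Proof.
have [f ->] := L1_surj u; have [g ->] := L1_surj v.
by rewrite -L1_classD !L1_norm_class; exact: ler_LnormD.
Qed.

Lemma L1_normZ (a : R) u : L1_norm (a *: u) = `|a| * L1_norm u.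
Proof.
have [f ->] := L1_surj u; rewrite -L1_classZ !L1_norm_class.
apply: EFin_inj; rewrite EFinM.
by rewrite !(@finite_norm_fine _ _ _ _ _ (lexx _)) -LnormZ.
Qed.

Lemma L1_norm0_eq0 u : L1_norm u = 0 -> u = 0.
Proof.
have [f ->] := L1_surj u; rewrite L1_norm_class => /fine_Lnormr_eq0 f0.
by apply/L1_eqP.
Qed.

HB.instance Definition _ := Lmodule_isNormed.Build R L1
  L1_normD L1_normZ L1_norm0_eq0.

End L1.

Section dimension.
Context {R : realType}.

Definition lin_indep (V : lmodType R) n (v : 'I_n -> V) :=
  forall c : 'I_n -> R, \sum_i c i *: v i = 0 -> forall i, c i = 0.

Definition dim_ge (V : lmodType R) n := exists v : 'I_n -> V, lin_indep v.

Definition finite_dimensional (V : lmodType R) :=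
  exists n (v : 'I_n -> V), forall x, exists c : 'I_n -> R,
    x = \sum_i c i *: v i.

End dimension.

Definition is_linear_subspace {R : realType} (V : lmodType R) (Y : set V) :=
  Y 0 /\ forall (a : R) (u v : V), Y u -> Y v -> Y (a *: u + v).

(* S is the inverse of the bounded operator T : E -> Y; since T is a bijection
   onto Y and both T and S are continuous, T is an isomorphism of E onto Y for
   the norm that Y inherits from W. *)
Definition linearly_isomorphic_to_subspace {R : realType}
    (E W : normedModType R) (Y : set W) :=
  exists (T : {linear E -> W}) (S : W -> E),
    [/\ range T = Y, cancel T S, continuous T & {within Y, continuous S}].

(* Main.v *)
From HB Require Import structures.
Require Import Defs.
From mathcomp Require Import all_boot all_order all_algebra.
From mathcomp Require Import all_classical all_reals all_analysis.
From mathcomp Require Import measurable_realfun ring lra.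
Set Implicit Arguments.
Unset Strict Implicit.
Unset Printing Implicit Defensive.
Import Order.TTheory GRing.Theory Num.Theory.
Import numFieldNormedType.Exports.
Local Open Scope classical_set_scope.
Local Open Scope ring_scope.

(* Let u, v be linearly independent and gamma_k(t) = 4^i(k) u + (t - k + 1) v
   for t in ]k, k + 1], where i is an injection of the integers k into nat.
   The embedding T sends the indicator of ]a, b] within ]k, k + 1] to
   delta (gamma_k b) - delta (gamma_k a); it is bounded because every f in
   Lip_0^ph is Lipschitz along the segments gamma_k, and it takes values in F^ph
   because such indicators span a dense subspace of L^1. For the lower bound,
   let sigma be the sign of w in L^1. Prescribing the value
   s * int_k^t sigma at s gamma_k(t), s >= 0, defines a Lipschitz function on a
   union of cones which, thanks to the lacunary factors 4^i(k), are far apart;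
   its McShane extension f is still positively homogeneous, and
   T w f = int w sigma = |w|_1. *)

(** * Lipschitz maps, closures and operators bounded below in normed spaces *)

Lemma dist_le_continuous (R : realType) (E W : normedModType R) (f : E -> W)
  (M : R) : (forall x y, `|f x - f y| <= M * `|x - y|) -> continuous f.
Proof.
move=> fM x; apply/cvgrPdist_le => e e0.
have [M0|M0] := leP M 0.
  apply: nearW => y; rewrite (le_trans (fM x y))//.
  by rewrite (le_trans _ (ltW e0))// mulr_le0_ge0.
near=> y; rewrite (le_trans (fM x y))//.
rewrite -ler_pdivlMl// mulrC.
by near: y; apply: cvgr_dist_le => //; rewrite divr_gt0.
Unshelve. all: by end_near. Qed.

Section normed_spaces.
Context {R : realType}.

Lemma closure_norm_lt (E : normedModType R) (A : set E) x : closure A x <->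
  forall e : R, 0 < e -> exists2 y, A y & `|x - y| < e.
Proof.
split=> [Ax e e0|Ax B /nbhs_ballP[e /= e0 eB]].
  have [y [Ay]] := Ax _ (nbhsx_ballx x e e0).
  by rewrite -ball_normE; exists y.
by have [y Ay xy] := Ax e e0; exists y; split=> //; apply: eB;
  rewrite -ball_normE.
Qed.

(** At a limit point [x], the values [phi n x] stay close, uniformly in [n], to the convergent
    sequence [phi n y] for a nearby [y], so they form a Cauchy sequence. *)
Lemma closed_convergence_set (E : normedModType R) (phi : nat -> E -> R)
    (M : R) :
    (forall n x y, `|phi n x - phi n y| <= M * `|x - y|) ->
  closed [set x | cvg (phi ^~ x @ \oo)].
Proof.
move=> phiM x /closure_norm_lt clx.
apply/cauchy_cvgP/cauchy_exP => e e0.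
have M1 : 0 < `|M| + 1 by rewrite ltr_wpDl.
have eM0 : 0 < e / 2 / (`|M| + 1) by rewrite !divr_gt0.
have [y /= cy xy] := clx _ eM0.
exists (lim (phi ^~ y @ \oo)).
have e20 : 0 < e / 2 by rewrite divr_gt0.
have /cvgrPdist_lt/(_ _ e20) := cy.
apply: filterS => n /= yn.
rewrite -ball_normE /= (le_lt_trans (ler_distD (phi n y) _ _))//.
rewrite [ltRHS](splitr e) ltr_leD//.
rewrite distrC (le_trans (phiM n x y))//.
rewrite ltr_pdivlMr// in xy; rewrite (le_trans _ (ltW xy))// mulrC ler_wpM2l//.
by rewrite (le_trans (ler_norm M))// lerDl.
Qed.

(** Completeness of [E] enters as convergence of absolutely convergent series, the form in which it
    is proved for L^1 below. Preimages of a fast approximation of [y] have summable increments by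
    the lower bound, so they converge, and the limit is sent to [y]. *)
Lemma closed_range_bounded_below (E W : normedModType R) (T : {linear E -> W})
    (M K : R) :
    (forall (x : nat -> E) (B : R), (forall n, \sum_(i < n) `|x i| <= B) ->
      cvg (\sum_(i < n) x i @[n --> \oo])) ->
    (forall x, `|T x| <= M * `|x|) -> (forall x, `|x| <= K * `|T x|) ->
  closed (range T).
Proof.
move=> complE TM TK y /closure_norm_lt cly.
pose del n : R := 2^-1 ^+ n.
have del0 n : 0 < del n by rewrite exprn_gt0// invr_gt0.
have delS n : del n.+1 = del n / 2 by rewrite /del exprSr.
have sdel n : \sum_(i < n) del i = 2 - 2 * del n.
  elim: n => [|n IHn]; first by rewrite big_ord0 /del expr0; ring.
  by rewrite big_ord_recr/= IHn delS; field.
have /choice[x xP] : forall n, exists x, `|y - T x| < del n.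
  by move=> n; have [_ [x _ <-] h] := cly _ (del0 n); exists x.
pose z n := x n.+1 - x n.
have Tz n : `|T (z n)| <= 2 * del n.
  rewrite linearB -(subrKA y) (le_trans (ler_normD _ _))//.
  have := xP n; have := xP n.+1; rewrite [`|T _ - _|]distrC delS.
  have := del0 n; lra.
have K0 : 0 <= `|K| by [].
(* The constant 4 is twice the full sum of the [del i], which is 2. *)
have zs n : \sum_(i < n) `|z i| <= `|K| * 4.
  apply: (@le_trans _ _ (\sum_(i < n) `|K| * 2 * del i)).
    apply: ler_sum => i _; rewrite (le_trans (TK _))// -mulrA.
    rewrite (le_trans (ler_wpM2r _ (ler_norm K)))// ler_wpM2l//.
  rewrite -mulr_sumr sdel -mulrA ler_wpM2l//.
  by have := del0 n; lra.
have /cvg_ex[/= l zl] := complE z _ zs.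
have xl : x @ \oo --> l + x 0%N.
  have E1 : x = fun n => \sum_(i < n) z i + x 0%N.
    apply/funext; elim=> [|n IHn]; first by rewrite big_ord0 add0r.
    by rewrite big_ord_recr/= addrAC -IHn /z subrKC.
  rewrite [X in X @ _]E1; apply: cvgD => //; exact: cvg_cst.
have cT : continuous T.
  by apply: (@dist_le_continuous _ _ _ _ M) => a b; rewrite -linearB.
exists (l + x 0%N) => //.
have h1 : T (x n) @[n --> \oo] --> T (l + x 0%N)
  by exact: (cvg_comp _ _ xl (cT _)).
have h2 : T (x n) @[n --> \oo] --> y.
  apply/cvgrPdist_lt => e e0.
  have /cvgrPdist_lt/(_ _ e0) : del @ \oo --> 0.
    by apply: cvg_expr; rewrite ger0_norm//; lra.
  apply: filterS => n /=; rewrite sub0r normrN gtr0_norm//.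
  exact: lt_trans.
by apply: (cvg_unique _ h1 h2); exact: norm_hausdorff.
Qed.

(** The inverse is chosen pointwise and is arbitrary off the range; on the range the lower bound
    makes it Lipschitz. *)
Lemma linearly_isomorphic_bounded_below (E W : normedModType R)
    (T : {linear E -> W}) (M K : R) :
    (forall x, `|T x| <= M * `|x|) -> (forall x, `|x| <= K * `|T x|) ->
  linearly_isomorphic_to_subspace E (range T).
Proof.
move=> TM TK.
have /choice[S SP] : forall y, exists x, range T y -> T x = y.
  move=> y; have [[x _ <-]|nTy] := pselect (range T y); first by exists x.
  by exists 0 => /nTy.
have ST : cancel T S.
  move=> x; apply/eqP; rewrite -subr_eq0 -normr_le0 (le_trans (TK _))//.
  by rewrite linearB SP ?subrr ?normr0 ?mulr0//; exists x.
exists T, S; split=> //.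
  by apply: (@dist_le_continuous _ _ _ _ M) => x y; rewrite -linearB.
apply/subspace_continuousP => _ [x _ <-]; apply/cvgrPdist_lt => e e0.
have K1 : 0 < `|K| + 1 by rewrite ltr_wpDl.
have : \forall y \near T x, `|T x - y| < e / (`|K| + 1).
  by apply: cvgr_dist_lt => //; rewrite divr_gt0.
rewrite near_withinE; apply: filterS => y xy [z _ zy] /=.
rewrite -zy /from_subspace !ST (le_lt_trans (TK _))// linearB zy.
move: xy; rewrite ltr_pdivlMr//; apply: le_lt_trans.
by rewrite mulrC ler_wpM2l// (le_trans (ler_norm K))// lerDl.
Qed.

Lemma linspan_mem (V : lmodType R) (A : set V) x : A x -> linspan A x.
Proof.
move=> Ax; exists 1%N, (fun=> 1), (fun=> x); split=> //.
by rewrite big_ord1 scale1r.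
Qed.

Lemma linspan_linear_subspace (V : lmodType R) (A : set V) :
  is_linear_subspace (linspan A).
Proof.
split=> [|a _ _ [n [c [x [Ax ->]]]] [m [d [y [Ay ->]]]]].
  by exists 0%N, (fun=> 0), (fun=> 0); split=> [[]//|]; rewrite big_ord0.
exists (n + m)%N, (fun i : 'I_(n + m)
  => match fintype.split i with inl j => a * c j | inr j => d j end),
  (fun i : 'I_(n + m) => match fintype.split i with inl j => x j | inr j => y j
    end); split.
  by move=> i; case: fintype.split.
rewrite big_split_ord/= scaler_sumr; congr (_ + _); apply: eq_bigr => i _.
  by rewrite (unsplitK (inl _ : 'I_n + 'I_m)) scalerA.
by rewrite (unsplitK (inr _ : 'I_n + 'I_m)).
Qed.

Lemma closure_linear_subspace (E : normedModType R) (A : set E) :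
  is_linear_subspace A -> is_linear_subspace (closure A).
Proof.
move=> [A0 linA]; split=> [|a x y /closure_norm_lt clx /closure_norm_lt cly].
  exact: subset_closure.
apply/closure_norm_lt => e e0.
have e20 : 0 < e / 2 by rewrite divr_gt0.
have a1 : 0 < `|a| + 1 by rewrite ltr_wpDl.
have [x' Ax' xx'] := clx _ (divr_gt0 e20 a1).
have [y' Ay' yy'] := cly _ e20.
exists (a *: x' + y'); first exact: linA.
rewrite opprD addrACA -scalerBr (le_lt_trans (ler_normD _ _))//.
rewrite [ltRHS](splitr e) ler_ltD// normrZ.
rewrite ltr_pdivlMr// in xx';
  rewrite (le_trans _ (ltW xx'))// mulrC ler_wpM2l//.
by rewrite lerDl.
Qed.

End normed_spaces.

(** * Classes of integrable functions and completeness of L^1 *)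

Section L1_class_of_function.
Context d (T : measurableType d) (R : realType).
Variable mu : {measure set T -> \bar R}.
Implicit Types (f g h : T -> R) (u v : L1 mu).

(* [Lclass f] is the zero class when [f] is not integrable. *)
Definition Lclass f : L1 mu :=
  L1_class (insubd (0 : LfunType mu (@lexx _ _ 1%E)) f).

Lemma integrable_L1_repr u : mu.-integrable setT (EFin \o L1_repr u).
Proof. exact/Lfun1_integrable/LfunP. Qed.

Lemma LclassE f (f1 : f \in Lfun mu 1%E) :
  Lclass f = L1_class (Lfun_Sub (@lexx _ _ 1%E) f1).
Proof.
congr L1_class; apply/val_inj; rewrite val_insubd.
by case: ifP => // /negP.
Qed.

Lemma LclassK f : mu.-integrable setT (EFin \o f) ->
  ((L1_repr (Lclass f) : T -> R) = f %[ae mu]).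
Proof.
move=> /Lfun1_integrable f1; rewrite LclassE.
exact: (L1_classK (Lfun_Sub (@lexx _ _ 1%E) f1)).
Qed.

Lemma Lclass_repr u : Lclass (L1_repr u) = u.
Proof.
rewrite -[RHS]L1_reprK /Lclass; congr L1_class; apply/val_inj.
by rewrite val_insubd; case: ifP => // /negP[]; exact: LfunP.
Qed.

Lemma Lclass_linear (a : R) f g : mu.-integrable setT (EFin \o f) ->
    mu.-integrable setT (EFin \o g) ->
  Lclass (fun x => a * f x + g x) = a *: Lclass f + Lclass g.
Proof.
move=> /Lfun1_integrable f1 /Lfun1_integrable g1.
rewrite (LclassE f1) (LclassE g1) -L1_classZ -L1_classD /Lclass.
congr L1_class; apply/val_inj.
rewrite val_insubd; case: ifP => //.
by rewrite (_ : (fun x => _) = a *: f + g)// rpredD// rpredZ.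
Qed.


Lemma norm_Lclass f : mu.-integrable setT (EFin \o f) ->
  `|Lclass f| = \int[mu]_x `|f x|.
Proof.
move=> /Lfun1_integrable f1; rewrite LclassE.
by rewrite [LHS]L1_norm_class Lnorm1.
Qed.

Lemma norm_L1 u : `|u| = \int[mu]_x `|L1_repr u x|.
Proof. by rewrite -[in LHS](Lclass_repr u) norm_Lclass//;
  exact: integrable_L1_repr. Qed.


(** Dominated convergence read in the norm of L^1; the majorant [g] also yields the integrability of
    the terms and of the limit. *)
Lemma Lclass_cvg (f_ : (T -> R)^nat) f (g : T -> \bar R) :
    (forall n, measurable_fun setT (f_ n)) -> measurable_fun setT f ->
    {ae mu, forall x, f_ ^~ x @ \oo --> f x} -> mu.-integrable setT g ->
    (forall n x, `|(f_ n x)%:E| <= g x)%E ->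
  (forall n, mu.-integrable setT (EFin \o f_ n)) /\
  mu.-integrable setT (EFin \o f) /\ (Lclass (f_ n)) @[n --> \oo] --> Lclass f.
Proof.
move=> mf_ mf ff ig fg.
have if_ n : mu.-integrable setT (EFin \o f_ n).
  apply: (le_integrable measurableT _ _ ig); first exact/measurable_EFinP.
  by move=> x _; rewrite (le_trans (fg n x))// lee_abs.
have [||||iF cv _] := @dominated_convergence _ _ _ mu setT measurableT
  (fun n => EFin \o f_ n) (EFin \o f) g _ _ _ ig _.
- by move=> n; exact/measurable_EFinP.
- exact/measurable_EFinP.
- apply: filterS ff => x fx _; apply: cvg_EFin => //; exact: nearW.
- by apply: aeW => x n _; exact: fg.
split=> //; split=> //.
apply/cvgrPdist_lt => e e0.
have /fine_cvgP[_ /cvgrPdist_lt/(_ _ e0)] := cv.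
apply: filterS => n /=; rewrite sub0r normrN => h.
rewrite distrC -[Lclass f]scale1r -scaleN1r scalerA mulr1 addrC.
rewrite -Lclass_linear// norm_Lclass//; last first.
  have -> : EFin \o (fun x => -1 * f x + f_ n x) = ((EFin \o f_ n)
    \- (EFin \o f))%E.
    by apply/funext => x /=; rewrite mulN1r addrC EFinB.
  exact: integrableB.
rewrite (le_lt_trans _ h)// (le_trans _ (ler_norm _))// /Rintegral le_eqVlt.
apply/orP; left; apply/eqP; congr fine; apply: eq_integral => x _ /=.
by rewrite mulN1r addrC.
Qed.

(** Riesz-Fischer in series form: the sum [G] of the absolute values is integrable by monotone
    convergence, hence finite almost everywhere. It dominates the partial sums, which converge
    wherever it is finite. *)
Lemma L1_cvg_series (v : (L1 mu)^nat) (M : R) :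
  (forall n, \sum_(i < n) `|v i| <= M) -> cvg (\sum_(i < n) v i @[n --> \oo]).
Proof.
move=> vM.
pose r i : T -> R := L1_repr (v i).
have mr i : measurable_fun setT (r i) by exact: measurable_funPT.
have mar i : measurable_fun setT (fun x => `|(r i x)%:E|%E).
  by apply: measurableT_comp => //; exact/measurable_EFinP.
pose G x : \bar R := (\sum_(i <oo) `|(r i x)%:E|)%E.
have G0 x : (0 <= G x)%E by exact: nneseries_ge0.
have mG : measurable_fun setT G.
  by apply: ge0_emeasurable_sum => // k x _ _.
have iG : mu.-integrable setT G.
  apply/integrableP; split=> //.
  under eq_integral do rewrite gee0_abs//.
  rewrite /G integral_nneseries//.
  apply: (@le_lt_trans _ _ M%:E); last exact: ltry.
  apply: lime_le.
    by apply: is_cvg_nneseries => n _ _; exact: integral_ge0.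
  apply: nearW => n; rewrite big_mkord.
  rewrite (eq_bigr (fun i : 'I_n => `|v i|%:E));
    first by rewrite sumEFin lee_fin; exact: vM.
  move=> i _; rewrite norm_L1 /Rintegral fineK//.
  apply: integrable_fin_num => //.
  exact: (integrable_norm (integrable_L1_repr _)).
pose S n x := \sum_(i < n) r i x.
have SG n x : (`|(S n x)%:E| <= G x)%E.
  apply: (@le_trans _ _ (\sum_(i < n) `|(r i x)%:E|)%E).
    by rewrite /S /= sumEFin lee_fin ler_norm_sum.
  rewrite -(big_mkord xpredT (fun i => `|(r i x)%:E|%E)).
  exact: nneseries_lim_ge.
have cS x : G x \is a fin_num -> cvgn (S ^~ x).
  move=> Gx; have -> : S ^~ x = series (r ^~ x).
    by apply/funext => n; rewrite /S seriesEord.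
  apply: normed_cvg; apply: nondecreasing_is_cvgn.
    by apply: nondecreasing_series => *; exact: normr_ge0.
  exists (fine (G x)) => _ [n _ <-].
  rewrite -lee_fin fineK// /series /= -sumEFin.
  exact: nneseries_lim_ge.
pose A := [set x | G x \is a fin_num].
have mA : measurable A.
  rewrite (_ : A = [set x | (G x < +oo)%E]).
    by rewrite -[X in measurable X]setTI; exact: emeasurable_fun_infty_o.
  by apply/seteqP; split => x; rewrite /A /= ge0_fin_numE.
(* The value 0 where [G] is infinite makes [f] the everywhere limit of the restrictions of [S n] to
   [A], hence measurable. *)
pose f x := if G x \is a fin_num then lim (S ^~ x @ \oo) else 0.
have mS n : measurable_fun setT (S n) by exact: measurable_sum.
have mf : measurable_fun setT f.
  apply: (@measurable_fun_cvg _ _ _ _ (fun n => (S n) \_ A)).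
    move=> n.
    by apply/(measurable_restrict _ mA measurableT); rewrite setTI;
      apply: measurable_funTS.
  move=> x _; rewrite /f /patch.
  have -> : (x \in A) = (G x \is a fin_num) by apply/idP/idP; rewrite inE.
  case: ifPn => Gx; last exact: cvg_cst.
  exact: cS.
have [|_ [_ fcv]] := @Lclass_cvg S f G mS mf _ iG SG.
  have := integrable_ae measurableT iG.
  by apply: filterS => x /(_ I) Gx; rewrite /f Gx; exact: cS.
apply/cvg_ex; exists (Lclass f); apply: cvg_trans fcv.
rewrite (_ : (fun n => Lclass (S n)) = (fun n => \sum_(i < n) v i))//.
apply/funext; elim=> [|n IHn].
  rewrite big_ord0; apply/eqP; rewrite -normr_eq0 norm_Lclass.
    rewrite (_ : (fun x => _) = fun=> 0); last first.
      by apply/funext => x; rewrite /S big_ord0 normr0.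
    by rewrite Rintegral_cst// mul0r.
  rewrite (_ : _ \o _ = cst 0%E); first exact: integrable0.
  by apply/funext => x; rewrite /S/= big_ord0.
rewrite big_ord_recr/= -IHn -(Lclass_repr (v n)) addrC -[X in X + _]scale1r.
rewrite -Lclass_linear.
- by congr Lclass; apply/funext => x; rewrite /S big_ord_recr/= addrC mul1r.
- exact: integrable_L1_repr.
- apply: (le_integrable measurableT _ _ iG); first exact/measurable_EFinP.
  by move=> x _; rewrite (le_trans (SG n x))// lee_abs.
Qed.

End L1_class_of_function.

(** * Pairing of L^1 with bounded measurable functions *)

Section L1_pairing.
Context d (T : measurableType d) (R : realType).
Variable mu : {measure set T -> \bar R}.
Implicit Types (f : T -> R) (u v : L1 mu).

Definition L1_pair (h : T -> R) u : R := \int[mu]_x (L1_repr u x * h x).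

Context (h : T -> R) (M : R).
Hypotheses (mh : measurable_fun setT h) (hM : forall x, `|h x| <= M).

Lemma integrable_mul_bounded f : mu.-integrable setT (EFin \o f) ->
  mu.-integrable setT (EFin \o (fun x => f x * h x)).
Proof.
move=> intf.
rewrite (_ : EFin \o _ = (EFin \o f) \* (EFin \o h))%E; last exact/funext.
apply: integrableMl => //; exists M; split; first by rewrite num_real.
by move=> y My x _ /=; rewrite (le_trans (hM x))// ltW.
Qed.

(** Two representatives of a class agree almost everywhere, so the pairing can be computed from [f]
    itself. *)
Lemma L1_pair_class f : mu.-integrable setT (EFin \o f) ->
  L1_pair h (Lclass mu f) = \int[mu]_x (f x * h x).
Proof.
move=> intf; congr fine; apply: ae_eq_integral => //.
- exact: (measurable_int mu (integrable_mul_bounded (integrable_L1_repr _))).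
- exact: (measurable_int mu (integrable_mul_bounded intf)).
- by apply: filterS (LclassK intf) => x fx _; rewrite fx.
Qed.

Lemma L1_pair_linear a u v :
  L1_pair h (a *: u + v) = a * L1_pair h u + L1_pair h v.
Proof.
have iu := integrable_L1_repr u; have iv := integrable_L1_repr v.
have iau : mu.-integrable setT (EFin \o (fun x => a * (L1_repr u x * h x))).
  exact: (integrableZl measurableT a (integrable_mul_bounded iu)).
rewrite -{1}(Lclass_repr u) -{1}(Lclass_repr v) -Lclass_linear// L1_pair_class.
  rewrite -RintegralZl//; last exact: integrable_mul_bounded.
  rewrite -RintegralD//; last exact: integrable_mul_bounded.
  by apply: eq_Rintegral => x _; rewrite mulrDl mulrA.
exact: (integrableD measurableT (integrableZl measurableT a iu) iv).
Qed.

Lemma L1_pair_le u : `|L1_pair h u| <= M * `|u|.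
Proof.
have iu := integrable_L1_repr u.
rewrite norm_L1 -RintegralZl//; last exact: integrable_norm.
apply: le_trans.
  by apply: le_normr_Rintegral => //; exact: integrable_mul_bounded.
apply: le_Rintegral => //.
- exact/integrable_norm/integrable_mul_bounded.
- exact: (integrableZl measurableT M (integrable_norm iu)).
- by move=> x _; rewrite normrM mulrC ler_wpM2r.
Qed.

End L1_pairing.

(** * Density in L^1 of the span of the indicators of intervals inside unit cells *)

Section interval_indicators_are_total.
Import HBSimple.
Context {R : realType}.
Notation mu := (@lebesgue_measure R).
Notation unit_itv k := (`]((k : int)%:~R : R), (((k : int)
  + 1)%R%:~R : R)]%classic).
Implicit Types (f : R -> R) (A : set R) (k : int).

Lemma integrable_restr_indic f A : measurable (A : set (measurableTypeR R)) ->
  mu.-integrable setT (EFin \o f) ->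
  mu.-integrable setT (EFin \o (fun x => f x * \1_A x)).
Proof.
move=> mA intf; apply: (@integrable_mul_bounded _ _ _ mu _ 1) => //.
by move=> x; rewrite indicE normr_nat lern1 leq_b1.
Qed.

Lemma integrable_indicI_itv A (a b : R) :
    measurable (A : set (measurableTypeR R)) ->
  mu.-integrable setT (EFin \o \1_(A `&` `]a, b]%classic)).
Proof.
move=> mA; have := integrable_restr_indic mA
  (integrable_indic_itv a b false false).
by congr integrable; apply/funext => x /=; rewrite indicI mulrC.
Qed.

Context (P : set (L1 mu)).
Hypotheses (linP : is_linear_subspace P) (clP : closed P).
Hypothesis itvP : forall k (a b : R),
  k%:~R <= a -> a <= b -> b <= (k + 1)%:~R ->
  P (Lclass mu \1_(`]a, b]%classic)).

Let PD f g :
    mu.-integrable setT (EFin \o f) -> mu.-integrable setT (EFin \o g) ->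
  P (Lclass mu f) -> P (Lclass mu g) -> P (Lclass mu (f \+ g)).
Proof.
move=> intf intg Pf Pg.
rewrite (_ : _ \+ _ = fun x => 1 * f x + g x).
  by rewrite Lclass_linear//; exact: linP.2.
by apply/funext => x; rewrite mul1r.
Qed.

Lemma Lclass_cst0 : Lclass mu (fun=> 0) = 0.
Proof.
apply/eqP; rewrite -normr_eq0 norm_Lclass; last exact: integrable0.
by rewrite (_ : (fun x => _) = fun=> 0) ?Rintegral_cst ?mul0r//;
  apply/funext => x; rewrite normr0.
Qed.

(** Pi-lambda argument, starting from the half-open intervals. Everything is cut by one cell, so
    that complements become differences of integrable indicators and countable unions have an
    integrable majorant. *)
Let P_indic k A : measurable (A : set (measurableTypeR R)) ->
  P (Lclass mu \1_(A `&` unit_itv k)).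
Proof.
have kk1 : (k%:~R : R) <= (k + 1)%:~R by rewrite ler_int lerDl.
move: A.
apply: (@dynkin_induction _ (measurableTypeR R) (@ocitv R)
  (fun A => P (Lclass mu \1_(A `&` unit_itv k)))) => //.
- exact: ocitvI.
- by rewrite setTI; exact: itvP.
- move=> _ [[a b] _ <-] /=.
  have -> : `]a, b]%classic `&` unit_itv k =
      `]Num.max a k%:~R, Num.min b (k + 1)%:~R]%classic.
    apply/seteqP; split => x /=; rewrite !in_itv/= gt_max le_min.
      by move=> [/andP[-> ->] /andP[-> ->]].
    by move=> /andP[/andP[-> ->] /andP[-> ->]].
  have [ab|ba] := leP (Num.max a k%:~R) (Num.min b (k + 1)%:~R).
    by apply: (@itvP k) => //;
      [rewrite le_max lexx orbT|rewrite ge_min lexx orbT].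
  rewrite set_itv_ge; last by rewrite bnd_simp -leNgt ltW.
  by rewrite indic0 -[cst _]/(fun=> 0) Lclass_cst0; exact: linP.1.
- move=> A mA PA.
  have -> : \1_(~` A `&` unit_itv k) =
      (fun x => -1 * \1_(A `&` unit_itv k) x + \1_(unit_itv k) x : R).
    apply/funext => x; rewrite !indicI indicC /= !indicE.
    by case: (x \in A); case: (x \in _);
      rewrite /= ?(mul1r, mul0r, mulr1, mulr0, mulN1r, addNr, oppr0, add0r).
  rewrite Lclass_linear;
    [|exact: integrable_indicI_itv|exact: integrable_indic_itv].
  by apply: linP.2 => //; apply: (@itvP k).
- move=> F mF tF PF.
  (* These finite unions grow by one disjoint set at a time, which adds indicators; dominated
     convergence then reaches the countable union. *)
  pose B n := (\bigcup_(i < n) F i) `&` unit_itv k.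
  have mU n : measurable (\bigcup_(i < n) F i : set (measurableTypeR R)).
    by apply: bigcup_measurable => i _; exact: mF.
  have mUU : measurable (\bigcup_i F i : set (measurableTypeR R)).
    by apply: bigcup_measurable => i _; exact: mF.
  have iB n : mu.-integrable setT (EFin \o \1_(B n))
    by exact: integrable_indicI_itv.
  have PB n : P (Lclass mu \1_(B n)).
    elim: n => [|n IHn].
      rewrite /B bigcup_mkord big_ord0 set0I indic0 -[cst _]/(fun=> 0)
        Lclass_cst0; exact: linP.1.
    have -> : \1_(B n.+1) = \1_(F n `&` unit_itv k) \+ \1_(B n) :> (R -> R).
      apply/funext => x; rewrite /B /= !indicI /= bigcup_mkord big_ord_recr/=
        -bigcup_mkord.
      rewrite -mulrDl; congr (_ * _).
      rewrite !indicE in_setU; have [Fx|] := boolP (x \in F n); last first.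
        by rewrite orbF add0r.
      rewrite orbT memNset ?addr0// => -[i /= ltin Fix].
      move/trivIsetP : tF => /(_ i n I I); rewrite neq_ltn ltin => /(_ isT).
      by apply/eqP/set0P; exists x; split=> //; exact/set_mem.
    apply: PD => //; exact: integrable_indicI_itv.
  have [|||||_ [_]] := @Lclass_cvg _ _ _ mu (fun n => \1_(B n))
    (\1_(\bigcup_i F i `&` unit_itv k)) (EFin \o \1_(unit_itv k)).
  + move=> n; apply/measurable_EFinP; exact: (measurable_int mu (iB n)).
  + apply/measurable_EFinP;
    exact: (measurable_int mu (integrable_indicI_itv _ _ mUU)).
  + apply: aeW => x; rewrite indicI /=.
    have [[i _ Fix]|nF] := pselect ((\bigcup_i F i) x).
      apply: cvg_near_cst; exists i.+1 => // n /= ltin.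
      rewrite indicI /=; congr (_ * _); rewrite !indicE !mem_set//;
        exists i => //.
    apply: cvg_near_cst; apply: nearW => n.
    rewrite indicI /=; congr (_ * _); rewrite !indicE !memNset// => -[i _ Fix].
    by apply: nF; exists i.
  + exact: integrable_indic_itv.
  + move=> n x; rewrite lee_fin indicI /= normrM.
    rewrite [`|\1_(unit_itv k) x|]ger0_norm//.
    by rewrite ler_piMl// indicE normr_nat lern1 leq_b1.
  + by apply: (@closed_cvg _ _ \oo _ (fun n => Lclass mu \1_(B n)) P clP);
    exact: nearW.
Qed.

(** On a cell, [f] is an L^1 limit of simple functions, and each of these is a finite combination of
    indicators of level sets. *)
Let P_unit_itv k f : mu.-integrable setT (EFin \o f) ->
  P (Lclass mu (fun x => f x * \1_(unit_itv k) x)).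
Proof.
move=> intf.
have mJ : measurable (unit_itv k : set (measurableTypeR R)) by [].
have ifJ : mu.-integrable (unit_itv k) (EFin \o f).
  exact: (integrableS measurableT mJ (@subsetT _ _) intf).
have [g [ig _ gf]] := approximation_sfun_integrable mJ ifJ.
have gJE n : EFin \o (fun x => g n x * \1_(unit_itv k) x) = (EFin \o g n)
  \_ (unit_itv k).
  by apply/funext => x /=; rewrite patchE indicE; case: ifP => _;
    rewrite ?mulr1 ?mulr0.
have fJE : EFin \o (fun x => f x * \1_(unit_itv k) x) = (EFin \o f)
  \_ (unit_itv k).
  by apply/funext => x /=; rewrite patchE indicE; case: ifP => _;
    rewrite ?mulr1 ?mulr0.
have igJ n : mu.-integrable setT (EFin \o (fun x => g n x * \1_(unit_itv k) x)).
  by rewrite gJE; exact/(integrable_mkcond _ mJ).1.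
have ifJ' : mu.-integrable setT (EFin \o (fun x => f x * \1_(unit_itv k) x)).
  by rewrite fJE; exact/(integrable_mkcond _ mJ).1.
apply: (@closed_cvg _ _ \oo _ (fun n => Lclass mu (fun x => g n x *
  \1_(unit_itv k) x)) P clP).
  apply: nearW => n.
  rewrite (_ : (fun x => _)
    = fun x => \sum_(y <- finmap.enum_fset (fset_set (range (g n))))
      y * \1_(g n @^-1` [set y] `&` unit_itv k) x); last first.
    apply/funext => x; rewrite fimfunE fsbig_finite// mulr_suml.
    by apply: eq_bigr => y _; rewrite indicI mulrA.
  elim: (finmap.enum_fset _) => [|y s IHs].
    rewrite (_ : (fun x => _) = fun=> 0); last by apply/funext => x;
      rewrite big_nil.
    by rewrite Lclass_cst0; exact: linP.1.
  have my (z : R) : measurable (g n @^-1` [set z] : set (measurableTypeR R)).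
    exact: measurable_sfunP.
  rewrite (_ : (fun x => _) = fun x => y * \1_(g n @^-1` [set y]
    `&` unit_itv k) x +
     \sum_(z <- s) z * \1_(g n @^-1` [set z] `&` unit_itv k) x); last first.
    by apply/funext => x; rewrite big_cons.
  rewrite Lclass_linear; last first.
  - rewrite (_ : EFin \o _ = fun x => (\sum_(z <- s)
        (z%:E * (\1_(g n @^-1` [set z] `&` unit_itv k) x)%:E))%E); last first.
      by apply/funext => x /=; rewrite -sumEFin.
    apply: integrable_sum => // z _; apply: integrableZl => //.
    exact: integrable_indicI_itv.
  - exact: integrable_indicI_itv.
  by apply: linP.2 => //; exact: P_indic.
apply/cvgrPdist_lt => e e0.
have /fine_cvgP[_ /cvgrPdist_lt/(_ _ e0)] := gf.
apply: filterS => n /=; rewrite sub0r normrN => h.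
rewrite distrC -[Lclass mu (fun x => f _ * _)]scale1r -scaleN1r scalerA mulr1
  addrC.
rewrite -Lclass_linear// norm_Lclass//; last first.
    exact: (integrableD measurableT (integrableZl measurableT (-1) ifJ')
      (igJ n)).
rewrite (le_lt_trans _ h)// (le_trans _ (ler_norm _))//
  [X in _ <= fine X]integral_mkcond.
rewrite le_eqVlt; apply/orP; left; apply/eqP; congr fine.
apply: eq_integral => x _ /=; rewrite patchE indicE distrC; case: ifP => _.
  by rewrite !mulr1 mulN1r addrC.
by rewrite !mulr0 addr0 normr0.
Qed.

(** Phrased with a closed subspace [P] to serve as an induction principle on L^1: convergence,
    membership in F^ph and equality of functionals are all proved through it. Intervals stay inside
    one cell because the path changes cone at the integers. *)
Lemma interval_indicators_total (u : L1 mu) : P u.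
Proof.
rewrite -(Lclass_repr u); set f : R -> R := L1_repr u.
have intf : mu.-integrable setT (EFin \o f) := integrable_L1_repr u.
pose J (n : nat) := `](- n%:R : R), n%:R]%classic.
pose F (n : nat) x := f x * \1_(J n) x.
have iF n : mu.-integrable setT (EFin \o F n)
  by apply: integrable_restr_indic => //; exact: measurable_itv.
have [|||||_ [_]] := @Lclass_cvg _ _ _ mu F f (EFin \o (fun x => `|f x|)).
- by move=> n; apply/measurable_EFinP; exact: (measurable_int mu (iF n)).
- by apply/measurable_EFinP; exact: (measurable_int mu intf).
- apply: aeW => x; apply: cvg_near_cst.
  exists (Num.bound `|x|) => // n /= xn; rewrite /F indicE mem_set ?mulr1//.
  have : `|x| < n%:R.
    by rewrite (lt_le_trans (archi_boundP (normr_ge0 x)))// ler_nat.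
  by rewrite /J /= in_itv/= ltr_norml => /andP[-> /ltW].
- exact: integrable_norm.
- move=> n x; rewrite lee_fin /F normrM ler_piMr//.
  by rewrite indicE normr_nat lern1 leq_b1.
apply: (@closed_cvg _ _ \oo _ (fun n => Lclass mu (F n)) P clP).
apply: nearW; elim=> [|n IHn].
  rewrite (_ : F 0%N = fun=> 0); first by rewrite Lclass_cst0; exact: linP.1.
  by apply/funext => x; rewrite /F /J oppr0 set_itv_ge ?bnd_simp ?ltxx//
    indic0 mulr0.
(* Passing from ]-n, n] to ]-(n + 1), n + 1] adds exactly the cells of index n and -(n + 1). *)
rewrite (_ : F n.+1 = F n \+ ((fun x => f x * \1_(unit_itv n) x) \+
   (fun x => f x * \1_(unit_itv (- n.+1%:Z)) x))).
  have ij k : mu.-integrable setT (EFin \o (fun x => f x * \1_(unit_itv k) x)).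
    by apply: integrable_restr_indic => //; exact: measurable_itv.
  apply: PD => //; first exact: (integrableD measurableT (ij _) (ij _)).
  apply: (PD (ij _) (ij _)); exact: P_unit_itv.
apply/funext => x.
suff E : \1_(J n.+1) x = \1_(J n) x + (\1_(unit_itv n) x +
    \1_(unit_itv (- n.+1%:Z)) x) :> R by rewrite /F E !mulrDr.
rewrite !indicE /J.
have -> : (- n.+1%:Z + 1)%R = - n%:Z by rewrite -addn1 PoszD opprD addrK.
have -> : (n%:Z + 1)%R = n.+1%:Z by rewrite -addn1 PoszD.
have H (a b : R) : (x \in `]a, b]%classic) = (a < x <= b)
  by rewrite mem_setE in_itv.
rewrite !H !mulrNz -!pmulrn -!natrD -natr1.
have n0 : (0 : R) <= n%:R by [].
move: (n%:R : R) n0 => N N0.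
have [h1|h1] := ltP (- (N + 1)) x; have [h2|h2] := leP x (N + 1);
have [h3|h3] := ltP (- N) x; have [h4|h4] := leP x N;
  rewrite /= ?addr0 ?add0r//; lra.
Qed.

End interval_indicators_are_total.

(** * McShane extension preserving positive homogeneity *)

Section mcshane.
Context {R : realType} (X : normedModType R) (I : Type).
Variables (A : set I) (p : I -> X) (w : I -> R) (L : R).
Hypotheses (L0 : 0 <= L) (A0 : A !=set0).
Hypothesis wp : forall i j s t, A i -> A j -> 0 <= s -> 0 <= t ->
  s * w i - t * w j <= L * `|s *: p i - t *: p j|.

(** McShane's infimum is taken over the whole rays spanned by the [p i], carrying the values
    [s * w i]: the family then scales with [x], which gives homogeneity. *)
Let vals x := [set si.1 * w si.2 + L * `|x - si.1 *: p si.2| |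
  si in [set si : R * I | 0 <= si.1 /\ A si.2]].

Let vals_neq0 x : vals x !=set0.
Proof.
have [i Ai] := A0.
by exists (0 * w i + L * `|x - 0 *: p i|), (0, i).
Qed.

Let vals_ge x : lbound (vals x) (- (L * `|x|)).
Proof.
move=> _ [[s i] /= [s0 Ai] <-].
(* The compatibility condition between the apex 0 and the point [s *: p i] bounds the family from
   below. *)
have := wp Ai Ai (lexx 0) s0; rewrite mul0r scale0r !sub0r normrN => h.
have : L * `|s *: p i| <= L * (`|x| + `|x - s *: p i|).
  by rewrite ler_wpM2l// -[X in `|X| <= _](subKr x) ler_normB.
lra.
Qed.

Let f x := inf (vals x).

Let f_le x s i : 0 <= s -> A i -> f x <= s * w i + L * `|x - s *: p i|.
Proof.
by move=> s0 Ai; apply: ge_inf; [exists (- (L * `|x|))|exists (s, i)].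
Qed.

Let f_lip x y : `|f x - f y| <= L * `|x - y|.
Proof.
suff H a b : f a <= f b + L * `|a - b|.
  have h1 := H x y; have h2 := H y x; rewrite distrC in h2.
  by rewrite ler_norml; lra.
rewrite -lerBlDr; apply: lb_le_inf => // _ [[s i] /= [s0 Ai] <-].
have := f_le a s0 Ai.
have : L * `|a - s *: p i| <= L * (`|a - b| + `|b - s *: p i|).
  by rewrite ler_wpM2l// ler_distD.
lra.
Qed.

Let f_eq i : A i -> f (p i) = w i.
Proof.
move=> Ai; apply/eqP; rewrite eq_le; apply/andP; split.
  by have := f_le (p i) ler01 Ai;
    rewrite scale1r subrr normr0 mulr0 addr0 mul1r.
apply: lb_le_inf => // _ [[s j] /= [s0 Aj] <-].
by have := wp Ai Aj ler01 s0; rewrite mul1r scale1r; lra.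
Qed.

(** Rescaling [s] by [a] gives one inequality for [a > 0]; the converse is the same inequality for
    the inverse of [a] at the point [a *: x]. *)
Let f_homog : pos_homogeneous f.
Proof.
have f0 : f 0 = 0.
  apply/eqP; rewrite eq_le; apply/andP; split.
    have [i Ai] := A0; have := f_le 0 (lexx 0) Ai.
    by rewrite mul0r scale0r subr0 normr0 mulr0 addr0.
  by apply: lb_le_inf => // z /vals_ge; rewrite normr0 mulr0 oppr0.
have H a x : 0 < a -> f (a *: x) <= a * f x.
  move=> a0; rewrite -ler_pdivrMl//;
    apply: lb_le_inf => // _ [[s i] /= [s0 Ai] <-].
  rewrite ler_pdivrMl//.
  have := f_le (a *: x) (mulr_ge0 (ltW a0) s0) Ai.
  by rewrite -scalerA -scalerBr normrZ gtr0_norm// mulrDr !mulrA [L * a]mulrC.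
move=> a x; rewrite le_eqVlt => /predU1P[<-|a0]; first by rewrite scale0r mul0r.
apply/eqP; rewrite eq_le H//=.
by rewrite -ler_pdivlMl// (le_trans _ (H _ _ _)) ?invr_gt0//
  scalerA mulVf ?scale1r// gt_eqF.
Qed.

Lemma mcshane_extension :
  exists2 g : Lip0ph X, `|g| <= L & forall i, A i -> g (p i) = w i.
Proof.
have fP : f \in @lip0ph_pred R X.
  by rewrite inE; split=> //; apply/lipschitz_bound; exists L.
exists (MkLip0ph fP) => //.
exact: lip_norm_le.
Qed.

End mcshane.

(** * Norms on a plane and estimates between cones *)

Section plane.
Context {R : realType} (X : normedModType R).

(** Equivalence of norms on a plane: the norm has a positive minimum over each of the segments u + t
    v and v + t u with |t| <= 1, and homogeneity brings every vector to one of them. *)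
Lemma lin_indep2_norm_ge (e : 'I_2 -> X) : lin_indep e ->
  exists2 c : R, 0 < c & forall a b : R, c * (`|a| + `|b|)
    <= `|a *: e ord0 + b *: e ord_max|.
Proof.
set u := e ord0; set v := e ord_max => indep.
have uv a b : a *: u + b *: v = 0 -> a = 0 /\ b = 0.
  move=> abuv; pose c (i : 'I_2) := if i == ord0 then a else b.
  have := indep c; rewrite big_ord_recl big_ord1 /c/= => /(_ _) H.
  have lm : lift ord0 ord0 = ord_max :> 'I_2 by apply/val_inj.
  rewrite lm in H; have {}H := H abuv.
  by split; [have := H ord0|have := H ord_max].
have mn (x y : X) : (forall t : R, x + t *: y != 0) ->
    exists2 c : R, 0 < c & forall t, `|t| <= 1 -> c <= `|x + t *: y|.
  move=> xy; have N11 : -1 <= 1 :> R by lra.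
  have [|t0 _ ht] := @EVT_min R (fun t => `|x + t *: y|) (-1) 1 N11.
    apply: continuous_subspaceT => t; apply: cvg_norm; apply: cvgD.
      exact: cvg_cst.
    by apply: cvgZr_tmp; exact: cvg_id.
  exists `|x + t0 *: y|; first by rewrite normr_gt0.
  by move=> t t1; apply: ht; rewrite in_itv/= -ler_norml.
have [|c c0 cP] := mn u v.
  move=> t; apply/eqP; rewrite -[u]scale1r => /uv[/eqP].
  by rewrite oner_eq0.
have [|d d0 dP] := mn v u.
  move=> t; apply/eqP; rewrite -[v]scale1r addrC => /uv[_ /eqP].
  by rewrite oner_eq0.
(* The larger coefficient [a] is factored out; the factor 1/2 pays for |a| + |b| <= 2 |a|. *)
have half (x y : X) (r a b : R) : 0 < r ->
    (forall t, `|t| <= 1 -> r <= `|x + t *: y|) -> `|b| <= `|a| ->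
    r / 2 * (`|a| + `|b|) <= `|a *: x + b *: y|.
  move=> r0 rP ba; have [a0|a0] := eqVneq a 0.
    move: ba; rewrite a0 normr0 normr_le0 => /eqP ->.
    by rewrite normr0 addr0 mulr0.
  have -> : a *: x + b *: y = a *: (x + (b / a) *: y).
    by rewrite scalerDr scalerA mulrCA mulfV// mulr1.
  have := rP (b / a); rewrite normrM normfV ler_pdivrMr ?normr_gt0// mul1r.
  move=> /(_ ba) H; rewrite normrZ.
  have := ler_wpM2l (normr_ge0 a) H.
  have := ler_wpM2l (ltW r0) ba.
  by lra.
exists (Num.min c d / 2) => [|a b].
  by rewrite divr_gt0// lt_min c0.
have [ba|/ltW ab] := leP `|b| `|a|.
  apply: le_trans (half u v c a b c0 cP ba).
  by rewrite ler_wpM2r ?addr_ge0// ler_pM2r// ge_min lexx.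
rewrite [`|a| + `|b|]addrC [a *: u + _]addrC;
  apply: le_trans (half v u d b a d0 dP ab).
by rewrite ler_wpM2r ?addr_ge0// ler_pM2r// ge_min lexx orbT.
Qed.

(** With [d1], [d2] the two differences, eliminating [t] gives s (N a - M b) = N d2 - b d1, where N
    a - M b >= N - 2 M >= N / 2. Hence s <= 2 |d2| + 4 |d1|. Since t <= t b = s a - d2 <= 2 s +
    |d2|, the sum s + t is at most 12 |d1| + 7 |d2|. *)
Lemma separated_cones (s t a b M N : R) : 0 <= s -> 0 <= t -> 1 <= M ->
    4 * M <= N -> 1 <= a <= 2 -> 1 <= b <= 2 ->
  s + t <= 12 * (`|s * M - t * N| + `|s * a - t * b|).
Proof.
move=> s0 t0 M1 MN /andP[a1 a2] /andP[b1 b2].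
have M0 : 0 < M by lra.
have N0 : 0 < N by lra.
have bge0 : 0 <= b by lra.
set d1 := s * M - t * N; set d2 := s * a - t * b.
have n1 := normr_ge0 d1; have n2 := normr_ge0 d2.
have e : s * (N * a - M * b) = N * d2 - b * d1 by rewrite /d1 /d2; ring.
have Nab : N / 2 <= N * a - M * b.
  have := ler_wpM2l (ltW N0) a1; have := ler_wpM2l (ltW M0) b2; lra.
have h1 : s * (N / 2) <= N * `|d2| + 2 * `|d1|.
  apply: (le_trans (ler_wpM2l s0 Nab)); rewrite e.
  have := ler_wpM2l (ltW N0) (ler_norm d2).
  have : - (b * d1) <= 2 * `|d1|.
    by rewrite (le_trans (ler_norm _))// normrN normrM (ger0_norm bge0)
      ler_wpM2r.
  lra.
have h2 : s <= 2 * `|d2| + 4 * `|d1|.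
  rewrite -(ler_pM2r N0).
  have : `|d1| * 1 <= `|d1| * N.
    by rewrite ler_wpM2l//; lra.
  nra.
have : t * 1 <= t * b by rewrite ler_wpM2l.
have : s * a <= s * 2 by rewrite ler_wpM2l.
have := ler_norm (- d2); rewrite normrN.
have : s * a - t * b = d2 by [].
lra.
Qed.

(** Splitting s p - t q as (s - t) p + t (p - q), and t (a - b) as (s a - t b) - a (s - t), bounds
    the left side by 3 |s - t| + |s a - t b|; then |s - t| <= |s N - t N| as N >= 1. The constant 12
    matches the case of distinct cones. *)
Lemma same_cone_lipschitz (s t a b N p q : R) : 0 <= s -> 0 <= t -> 1 <= N ->
    1 <= a <= 2 -> `|p| <= 1 -> `|p - q| <= `|a - b| ->
  s * p - t * q <= 12 * (`|s * N - t * N| + `|s * a - t * b|).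
Proof.
move=> s0 t0 N1 /andP[a1 a2] p1 pq.
have st : `|s - t| <= `|s * N - t * N|.
  by rewrite -mulrBl normrM ler_peMr// (le_trans N1)// ler_norm.
have h1 : (s - t) * p <= `|s - t|.
  by rewrite (le_trans (ler_norm _))// normrM ler_piMr.
have h2 : t * (p - q) <= t * `|a - b|.
  by rewrite ler_wpM2l// (le_trans (ler_norm _)).
have h3 : t * `|a - b| <= 2 * `|s - t| + `|s * a - t * b|.
  rewrite -{1}(ger0_norm t0) -normrM.
  have -> : t * (a - b) = - (a * (s - t)) + (s * a - t * b) by ring.
  rewrite (le_trans (ler_normD _ _))// lerD2r normrN normrM.
  by rewrite ler_wpM2r// ger0_norm//; lra.
have := normr_ge0 (s * a - t * b); have := normr_ge0 (s - t).
have -> : s * p - t * q = (s - t) * p + t * (p - q) by ring.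
lra.
Qed.

End plane.

(** * Lipschitz functions with prescribed profiles on lacunary cones *)

Section cones.
Context {R : realType} (X : normedModType R) (u v : X) (c : R).
Hypothesis c0 : 0 < c.
Hypothesis uvP : forall a b : R, c * (`|a| + `|b|) <= `|a *: u + b *: v|.

(* The slopes of the vectors [cone_pt k t], for t in [1, 2], lie in
   [1, 2] / 4 ^ pickle k, so that the cones they span for distinct [k] are
   separated, with gaps comparable to their apertures. *)
Definition cone_scale (k : int) : R := 4 ^+ pickle k.
Definition cone_pt (k : int) (t : R) : X := cone_scale k *: u + t *: v.

Lemma cone_scale_ge1 k : 1 <= cone_scale k.
Proof. by rewrite exprn_ege1// ler1n. Qed.

Lemma cone_scale_lt k j : (pickle k < pickle j)%N ->
  4 * cone_scale k <= cone_scale j.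
Proof. by move=> kj; rewrite /cone_scale -exprS ler_weXn2l// ler1n. Qed.

(** McShane extension from the union of the cones. Across two cones, values differ by at most s + t,
    which separation controls; within a cone the Lipschitz bound on the profile is used. The norm
    bound is the 12 of the planar estimates divided by the constant [c] comparing coordinates with
    the norm. *)
Lemma Lip0ph_of_profiles (h : int -> R -> R) :
    (forall k t, 1 <= t <= 2 -> `|h k t| <= 1) ->
    (forall k s t, 1 <= s <= 2 -> 1 <= t <= 2 ->
      `|h k s - h k t| <= `|s - t|) ->
  exists2 f : Lip0ph X, `|f| <= 12 / c &
    forall k t, 1 <= t <= 2 -> f (cone_pt k t) = h k t.
Proof.
move=> h1 hl.
have [|||f fc fh] := @mcshane_extension R X (int * R)%type
  [set kt | 1 <= kt.2 <= 2] (fun kt => cone_pt kt.1 kt.2)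
  (fun kt => h kt.1 kt.2) (12 / c).
- by rewrite divr_ge0// ltW.
- by exists (0, 1) => /=; lra.
- move=> [k a] [j b] s t /= a12 b12 s0 t0.
  have -> : s *: cone_pt k a - t *: cone_pt j b =
      (s * cone_scale k - t * cone_scale j) *: u + (s * a - t * b) *: v.
    by rewrite !scalerBl !scalerDr !scalerA opprD addrACA.
  rewrite (@le_trans _ _ (12 * (`|s * cone_scale k - t * cone_scale j| +
     `|s * a - t * b|)))//; last first.
    by rewrite -mulrA ler_wpM2l// ler_pdivlMl.
  have st : s * h k a - t * h j b <= s + t.
    have := h1 k a a12; have := h1 j b b12; rewrite !ler_norml.
    by move=> /andP[? ?] /andP[? ?]; nra.
  (* The two strict cases are symmetric; equal codes mean the same cone, [pickle] being
     injective. *)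
  have [kj|kj|kj] := ltngtP (pickle k) (pickle j).
  + apply: (le_trans st); apply: separated_cones => //.
    * exact: cone_scale_ge1.
    * exact: cone_scale_lt.
  + apply: (le_trans st); rewrite addrC distrC [`|s * a - _|]distrC.
    apply: separated_cones => //.
    * exact: cone_scale_ge1.
    * exact: cone_scale_lt.
  + have {kj} -> : k = j by exact: (pcan_inj pickleK).
    apply: same_cone_lipschitz => //; first exact: cone_scale_ge1.
    * exact: h1.
    * exact: hl.
by exists f => // k t t12; exact: (fh (k, t)).
Qed.

End cones.

(** * Integrals over half-open intervals *)

Section interval_integrals.
Context {R : realType}.
Notation mu := (@lebesgue_measure R).
Implicit Types (f : R -> R) (a b c M : R).

Lemma integrable_bounded_itv f a b M :
    measurable_fun (setT : set (measurableTypeR R)) f ->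
  (forall x, `|f x| <= M) -> mu.-integrable `]a, b]%classic (EFin \o f).
Proof.
move=> mf fM; apply: measurable_bounded_integrable => //.
- by rewrite /= lebesgue_measure_itv/=; case: ifP => _; rewrite ltry.
- exact: measurable_funTS.
- exists M; split; first by rewrite num_real.
  by move=> y My x _ /=; rewrite (le_trans (fM x))// ltW.
Qed.

Lemma integrable_continuous_itv f a b : continuous f ->
  mu.-integrable `]a, b]%classic (EFin \o f).
Proof.
move=> cf; apply: (@integrableS _ _ _ mu `[a, b]%classic) => //.
  by apply: subset_itvr; rewrite bnd_simp.
apply: continuous_compact_integrable; first exact: segment_compact.
exact: continuous_subspaceT.
Qed.

Lemma Rintegral_itv_cat f a b c : a <= b -> b <= c ->
    mu.-integrable `]a, c]%classic (EFin \o f) ->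
  \int[mu]_(x in `]a, c]) f x =
  \int[mu]_(x in `]a, b]) f x + \int[mu]_(x in `]b, c]) f x.
Proof.
move=> ab bc intf.
by rewrite -(@Rintegral_itvB _ f (BRight a) (BRight c) b) ?bnd_simp//
  addrC subrK.
Qed.

Lemma normr_Rintegral_itv f a b M : a <= b ->
    mu.-integrable `]a, b]%classic (EFin \o f) ->
    (forall x, a < x <= b -> `|f x| <= M) ->
  `|\int[mu]_(x in `]a, b]) f x| <= M * (b - a).
Proof.
move=> ab intf fM; apply: (le_trans (le_normr_Rintegral _ intf)) => //.
have ic : mu.-integrable `]a, b]%classic (EFin \o (fun=> M)).
  by apply: integrable_continuous_itv => x; exact: cvg_cst.
apply: (@le_trans _ _ (\int[mu]_(x in `]a, b]) M)).
  apply: le_Rintegral => //; first exact: integrable_norm.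
rewrite Rintegral_cst//= lebesgue_measure_itv/= lte_fin.
by case: ltP => //= ba; rewrite (_ : b = a) ?subrr//; apply/eqP;
  rewrite eq_le ab ba.
Qed.

Lemma Rintegral_itv_shift f a b h : a <= b -> continuous f ->
  \int[mu]_(x in `]a, b]) f (x + h) = \int[mu]_(x in `]a + h, b + h]) f x.
Proof.
move=> ab cf.
have cfh : continuous (fun x => f (x + h)).
  move=> x; apply: (@continuous_comp _ _ _ (fun x => x + h) f); last exact: cf.
  by apply: cvgD; [exact: cvg_id|exact: cvg_cst].
rewrite !Rintegral_itv_obnd_cbnd; [|exact: integrable_continuous_itv..].
have dh : (fun x => x + h)^`()%classic = cst 1.
  by apply/funext => z; rewrite derive1E deriveD// derive_cst derive_id addr0.
congr fine; rewrite (@integration_by_substitution_increasing _ (fun x => x + h)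
  f)//.
- apply: eq_integral => x _; congr (_%:E).
  by rewrite !fctE dh mulr1.
- by move=> x y _ _; rewrite ltrD2r.
- by rewrite dh => ? _; exact: cvg_cst.
- by rewrite dh; exact: is_cvg_cst.
- by rewrite dh; exact: is_cvg_cst.
- split=> //.
  + by apply: cvg_at_right_filter; apply: cvgD; [exact: cvg_id|exact: cvg_cst].
  + by apply: cvg_at_left_filter; apply: cvgD; [exact: cvg_id|exact: cvg_cst].
- exact: continuous_subspaceT.
Qed.

(** After translation the integral telescopes to the integral of [f] over ]b, b + h] minus that over
    ]a, a + h]; each is within M h^2 of [h] times the value of [f] at the left end. *)
Lemma Rintegral_increment f a b h M : a <= b -> 0 <= h -> 0 <= M ->
    (forall x y, `|f x - f y| <= M * `|x - y|) ->
  `|\int[mu]_(x in `]a, b]) (f (x + h) - f x) - h * (f b - f a)|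
     <= 2 * M * h * h.
Proof.
move=> ab h0 M0 fM; have cf : continuous f by exact: dist_le_continuous fM.
have cfh : continuous (fun x => f (x + h)).
  move=> x; apply: (@continuous_comp _ _ _ (fun x => x + h) f); last exact: cf.
  by apply: cvgD; [exact: cvg_id|exact: cvg_cst].
have icf x y : mu.-integrable `]x, y]%classic (EFin \o f).
  exact: integrable_continuous_itv.
rewrite RintegralB//; last exact: integrable_continuous_itv.
rewrite Rintegral_itv_shift//.
have H c : `|\int[mu]_(x in `]c, c + h]) f x - h * f c| <= M * h * h.
  have -> : h * f c = \int[mu]_(x in `]c, c + h]) f c.
    rewrite Rintegral_cst//= lebesgue_measure_itv/= lte_fin.
    have -> : (c < c + h) = (0 < h) by rewrite ltrDl.
    rewrite -EFinB mulrC; case: ltP => [_|] /=; first by congr (_ * _); ring.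
    by move=> h0'; congr (_ * _); apply/eqP; rewrite eq_le h0 h0'.
  have ic : mu.-integrable `]c, c + h]%classic (EFin \o (fun=> f c)).
    by apply: integrable_continuous_itv => x; exact: cvg_cst.
  rewrite -RintegralB//.
  have := @normr_Rintegral_itv (fun x => f x - f c) c (c + h) (M * h).
  have -> : c + h - c = h by ring.
  apply; rewrite ?lerDl//.
  - by have := integrableB _ (icf c (c + h)) ic; apply.
  - move=> x /andP[cx xh]; rewrite (le_trans (fM _ _))// ler_wpM2l//.
    by rewrite ger0_norm; lra.
have bh : b <= b + h by rewrite lerDl.
have ah : a <= a + h by rewrite lerDl.
have abh : a + h <= b + h by rewrite lerD2r.
have e1 := Rintegral_itv_cat ab bh (icf _ _).
have e2 := Rintegral_itv_cat ah abh (icf _ _).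
have Ha := H a; have Hb := H b.
move: Ha Hb; rewrite !ler_norml => /andP[? ?] /andP[? ?].
lra.
Qed.

Lemma measurable_fun_unit_itv f :
    (forall k : int, measurable_fun
      (`]k%:~R, (k + 1)%:~R]%classic : set (measurableTypeR R)) f) ->
  measurable_fun (setT : set (measurableTypeR R)) f.
Proof.
move=> mf.
(* The cells are enumerated through [pickle]; a number coding no integer repeats the cell of index
   0. *)
pose E (i : nat) : set (measurableTypeR R) :=
  let k : int := odflt 0 (unpickle i) in `]k%:~R, (k + 1)%:~R]%classic.
have -> : (setT : set (measurableTypeR R)) = \bigcup_i E i.
  (* Cells are closed on the right, so the cell of [x] has index ceil x - 1 rather than floor x. *)
  apply/esym; rewrite -subTset => x _; exists (pickle (Num.ceil x - 1)) => //.
  by rewrite /E pickleK/= in_itv/= subrK ceil_itv.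
apply/measurable_fun_bigcup => i; first exact: measurable_itv.
exact: mf.
Qed.

End interval_integrals.

(** * The path through the cones and difference quotients along it *)

Section cone_path.
Context {R : realType} (X : normedModType R) (u v : X).
Notation mu := (@lebesgue_measure R).

(* The path is used for t in ]k, k + 1], where it runs at constant speed
   [`|v|] along a segment of the k-th cone. *)
Definition cone_path (k : int) (t : R) : X := cone_pt u v k (t - k%:~R + 1).

Lemma cone_path_lipschitz (f : Lip0ph X) k (s t : R) :
  `|f (cone_path k s) - f (cone_path k t)| <= `|f| * `|v| * `|s - t|.
Proof.
rewrite (le_trans (lip_normP _ _ _))// -mulrA ler_wpM2l ?lip_norm_ge0//.
rewrite /cone_path /cone_pt opprD addrACA subrr add0r -scalerBl normrZ mulrC.
by rewrite (_ : s - _ + 1 - _ = s - t)//; ring.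
Qed.

(** The profile on cone [k] is the primitive of [sigma] from [k], the cone parameter t in [1, 2]
    standing for the position k + t - 1. It is bounded by 1 because a cell has length 1, and
    1-Lipschitz because |sigma| <= 1. *)
Lemma Lip0ph_of_density (c : R) (sigma : R -> R) : 0 < c ->
    (forall a b : R, c * (`|a| + `|b|) <= `|a *: u + b *: v|) ->
    measurable_fun (setT : set (measurableTypeR R)) sigma ->
    (forall x, `|sigma x| <= 1) ->
  exists2 f : Lip0ph X, `|f| <= 12 / c &
    forall (k : int) (a b : R), k%:~R <= a -> a <= b -> b <= (k + 1)%:~R ->
      f (cone_path k b) - f (cone_path k a) = \int[mu]_(x in `]a, b]) sigma x.
Proof.
move=> c0 uvP msig sig1.
have isig a b := @integrable_bounded_itv _ _ a b _ msig sig1.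
pose h (k : int) t := \int[mu]_(x in `]k%:~R, k%:~R + (t - 1)]) sigma x.
have hB (k : int) s t : 1 <= s -> s <= t ->
    h k t - h k s = \int[mu]_(x in `]k%:~R + (s - 1), k%:~R + (t - 1)]) sigma x.
  move=> s1 st; rewrite /h (@Rintegral_itv_cat _ _ _ (k%:~R + (s - 1)))//.
  - by rewrite addrC addKr.
  - by rewrite lerDl subr_ge0.
  - by rewrite lerD2l lerD2r.
have [||f fc fh] := Lip0ph_of_profiles c0 uvP (h := h).
- move=> k t /andP[t1 t2]; rewrite /h.
  rewrite (le_trans (normr_Rintegral_itv _ (isig _ _) (fun x _ => sig1 x)))//.
    by rewrite lerDl subr_ge0.
  by rewrite mul1r addrC addKr; lra.
- suff H k s t : 1 <= s -> s <= t -> `|h k s - h k t| <= `|s - t|.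
    move=> k s t /andP[s1 _] /andP[t1 _].
    have [st|/ltW ts] := leP s t; first exact: H.
    by rewrite distrC [leRHS]distrC; exact: H.
  move=> s1 st; rewrite distrC hB//.
  rewrite (le_trans (normr_Rintegral_itv _ (isig _ _) (fun x _ => sig1 x)))//.
    by rewrite lerD2l lerD2r.
  by rewrite mul1r distrC ger0_norm ?subr_ge0//; lra.
exists f => // k a b ka ab bk.
move: bk; rewrite intrD => bk.
rewrite /cone_path !fh; [|lra..].
rewrite hB; [|lra..].
have e (x : R) : k%:~R + (x - k%:~R + 1 - 1) = x by ring.
by rewrite !e.
Qed.

(* As [n] grows these functions play the role of the derivative of [f] along
   the path; only the convergence of their integrals against L^1 functions is
   needed, so that no differentiability theorem is involved. *)
Definition path_quotient (f : Lip0ph X) (n : nat) (t : R) : R :=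
  let k := Num.ceil t - 1 in
  n.+1%:R * (f (cone_path k (t + n.+1%:R^-1)) - f (cone_path k t)).

(** Uniformity in [n] gives the pairings with L^1 a common Lipschitz constant, and later the norm
    bound on the embedding. *)
Lemma path_quotient_le f n t : `|path_quotient f n t| <= `|f| * `|v|.
Proof.
rewrite /path_quotient normrM normr_nat mulrC -ler_pdivlMr//.
rewrite (le_trans (cone_path_lipschitz _ _ _ _))//.
by rewrite addrC addKr ger0_norm// invr_ge0.
Qed.

(** The index remains that of the cell of [t] even if t + 1/(n + 1) exceeds k + 1: the segment is
    then continued along its own line. *)
Lemma path_quotientE f n (k : int) (t : R) : k%:~R < t <= (k + 1)%:~R ->
  path_quotient f n t =
  n.+1%:R * (f (cone_path k (t + n.+1%:R^-1)) - f (cone_path k t)).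
Proof.
move=> kt; rewrite /path_quotient (_ : Num.ceil t - 1 = k)//.
by rewrite (@ceil_def _ t (k + 1)) ?addrK.
Qed.

Lemma continuous_path_increment (f : Lip0ph X) k (h : R) :
  continuous (fun t : R => f (cone_path k (t + h)) - f (cone_path k t)).
Proof.
apply: (@dist_le_continuous R R R _ (2 * (`|f| * `|v|))) => s t.
have h1 := cone_path_lipschitz f k s t.
have h2 := cone_path_lipschitz f k (s + h) (t + h).
have e : s + h - (t + h) = s - t by ring.
rewrite e in h2.
move: h1 h2; rewrite !ler_norml => /andP[? ?] /andP[? ?].
by apply/andP; split; lra.
Qed.

Lemma measurable_path_quotient f n :
  measurable_fun (setT : set (measurableTypeR R)) (path_quotient f n).
Proof.
apply: measurable_fun_unit_itv => k.
pose g (t : R) := n.+1%:R * (f (cone_path k (t + n.+1%:R^-1))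
  - f (cone_path k t)).
apply: (@eq_measurable_fun _ _ _ _ _ g).
  by move=> t; rewrite inE/= in_itv/= => kt; rewrite (path_quotientE _ _ kt).
apply: measurable_funTS; apply: continuous_measurable_fun.
by move=> t; apply: cvgM; [exact: cvg_cst|exact: continuous_path_increment].
Qed.

Lemma path_quotient_linear a f g n t :
  path_quotient (a *: f + g) n t =
  a * path_quotient f n t + path_quotient g n t.
Proof.
rewrite /path_quotient.
have E x : (a *: f + g : Lip0ph X) x = a * f x + g x by [].
by rewrite !E; ring.
Qed.

(** For the step h = 1/(n + 1), the estimate on integrated increments leaves an error of (n + 1) 2 C
    h^2 = 2 C / (n + 1). *)
Lemma cvg_path_quotient_itv f (k : int) (a b : R) :
    k%:~R <= a -> a <= b -> b <= (k + 1)%:~R ->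
  @L1_pair _ _ _ mu (path_quotient f n) (Lclass mu \1_(`]a, b]%classic))
    @[n --> \oo] -->
    f (cone_path k b) - f (cone_path k a).
Proof.
move=> ka ab bk; set C := `|f| * `|v|.
have C0 : 0 <= C by rewrite mulr_ge0.
have E n : @L1_pair _ _ _ mu (path_quotient f n) (Lclass mu \1_(`]a,
  b]%classic)) =
   n.+1%:R * \int[mu]_(x in `]a, b]) (f (cone_path k (x + n.+1%:R^-1))
     - f (cone_path k x)).
  rewrite (L1_pair_class (measurable_path_quotient f n)
    (path_quotient_le f n)); last first.
    exact: integrable_indic_itv.
  rewrite -RintegralZl//; last first.
    exact/integrable_continuous_itv/continuous_path_increment.
  rewrite [RHS]Rintegral_mkcond; apply: eq_Rintegral => x _.
  rewrite patchE indicE; case: ifPn => [|_]; last by rewrite mul0r.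
  rewrite inE/= in_itv/= mul1r => /andP[ax xb]; apply: path_quotientE.
  by rewrite (le_lt_trans ka ax) (le_trans xb bk).
apply/cvgrPdist_le => e e0.
have : 2 * C * n.+1%:R^-1 @[n --> \oo] --> 0 * (2 * C).
  by under eq_fun do rewrite mulrC; apply: cvgMr_tmp; exact: cvg_harmonic.
rewrite mul0r => /cvgrPdist_le/(_ _ e0); apply: filterS => n /=.
rewrite sub0r normrN E distrC => /(le_trans (ler_norm _)) h.
have n0 : (0 : R) <= n.+1%:R^-1 by rewrite invr_ge0.
have := Rintegral_increment ab n0 C0 (cone_path_lipschitz f k).
rewrite -(ler_pM2l (ltr0Sn R n)) -[X in X * `|_|]normr_nat -normrM mulrBr.
rewrite [n.+1%:R * (n.+1%:R^-1 * _)]mulrA mulfV ?pnatr_eq0// mul1r => H.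
rewrite (le_trans H)// (le_trans _ h)// le_eqVlt; apply/orP; left; apply/eqP.
by rewrite mulrC divfK ?pnatr_eq0.
Qed.

(** The classes where convergence holds form a subspace, closed since the pairings are uniformly
    Lipschitz in [w], and containing the interval indicators. *)
Lemma cvg_path_quotient f (w : L1 mu) :
  cvg (@L1_pair _ _ _ mu (path_quotient f n) w @[n --> \oo]).
Proof.
have lin n := L1_pair_linear (mu := mu) (measurable_path_quotient f n)
  (path_quotient_le f n).
apply: (@interval_indicators_total _
  [set w : L1 mu | cvg (@L1_pair _ _ _ mu (path_quotient f n) w @[n --> \oo])]).
- split=> [|a x y /= cx cy].
    rewrite /= (_ : (fun n => _) = fun=> 0); first exact: is_cvg_cst.
    apply/funext => n; have := lin n 1 0 0.
    by rewrite scaler0 addr0 mul1r => /eqP;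
      rewrite -subr_eq0 opprD addrA subrr sub0r oppr_eq0 => /eqP.
  under eq_fun do rewrite lin.
  apply: is_cvgD; last exact: cy.
  by apply: is_cvgM; [exact: is_cvg_cst|exact: cx].
- apply: (@closed_convergence_set _ (L1 mu)
  (fun n w => @L1_pair _ _ _ mu (path_quotient f n) w) (`|f| * `|v|)) => n x y.
  rewrite addrC -mulN1r -lin scaleN1r addrC.
  exact: L1_pair_le (measurable_path_quotient f n) (path_quotient_le f n) _.
- move=> k a b ka ab bk /=; apply/cvg_ex.
  exists (f (cone_path k b) - f (cone_path k a)).
  exact: cvg_path_quotient_itv ka ab bk.
Qed.

End cone_path.

(** * The embedding of L^1 into F^ph and its two-sided bounds *)

Section embedding.
Context {R : realType} (X : normedModType R) (u v : X).
Notation mu := (@lebesgue_measure R).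
Notation quot f n w := (@L1_pair _ _ _ mu (path_quotient u v f n) w).
Implicit Types (f g : Lip0ph X) (w : L1 mu).

(** Plays the part of the integral of [w] against the derivative of [f] along the path. *)
Let embed_fun w f : R := lim (quot f n w @[n --> \oo]).

Let embed_fun_linear w : linear (embed_fun w).
Proof.
move=> a f g; rewrite /embed_fun.
have E n : quot (a *: f + g) n w = a * quot f n w + quot g n w.
  have int h := integrable_mul_bounded (measurable_path_quotient u v h n)
    (path_quotient_le u v h n) (integrable_L1_repr w).
  rewrite /L1_pair -RintegralZl//.
  rewrite -RintegralD//; last exact: (integrableZl measurableT a (int f)).
  by apply: eq_Rintegral => x _; rewrite path_quotient_linear; ring.
under eq_fun do rewrite E.
apply: cvg_lim => //.
apply: cvgD; last exact: cvg_path_quotient.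
by apply: cvgM; [exact: cvg_cst|exact: cvg_path_quotient].
Qed.

Let embed_fun_le w f : `|embed_fun w f| <= `|v| * `|w| * `|f|.
Proof.
rewrite /embed_fun.
have c : cvg (quot f n w @[n --> \oo]) by exact: cvg_path_quotient.
have cn : `|quot f n w| @[n --> \oo] --> `|lim (quot f n w @[n --> \oo])|.
  exact: cvg_norm.
rewrite -(cvg_lim _ cn)//; apply: limr_le; first by apply: cvgP cn.
apply: nearW => n; rewrite mulrC mulrA.
exact: L1_pair_le (measurable_path_quotient u v f n) (path_quotient_le u v f n)
  _.
Qed.

Let embed_funP w : embed_fun w \in @dual_pred R (Lip0ph X).
Proof.
rewrite inE; split; first exact: embed_fun_linear.
apply: (@dist_le_continuous R (Lip0ph X) R _ (`|v| * `|w|)) => f g.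
rewrite (_ : embed_fun w f - embed_fun w g = embed_fun w (f - g)).
  exact: embed_fun_le.
by rewrite addrC -mulN1r -[RHS]/(embed_fun w _)
  -embed_fun_linear scaleN1r addrC.
Qed.

Let embed_val w : dual (Lip0ph X) := MkDual (embed_funP w).

Let embed_val_linear : linear embed_val.
Proof.
move=> a w1 w2; apply/val_inj/funext => f /=.
change (embed_fun (a *: w1 + w2) f = a * embed_fun w1 f + embed_fun w2 f).
rewrite /embed_fun.
under eq_fun do rewrite (L1_pair_linear (measurable_path_quotient u v f _)
  (path_quotient_le u v f _)).
apply: cvg_lim => //.
apply: cvgD; last exact: cvg_path_quotient.
by apply: cvgM; [exact: cvg_cst|exact: cvg_path_quotient].
Qed.

HB.instance Definition _ := GRing.isLinear.Build R (L1 mu) (dual (Lip0ph X)) _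
  embed_val embed_val_linear.

Definition L1_embedding : {linear L1 mu -> dual (Lip0ph X)} := embed_val.

Lemma L1_embedding_le w : `|L1_embedding w| <= `|v| * `|w|.
Proof. by apply: dual_norm_le => [|f]; rewrite ?mulr_ge0//;
  exact: embed_fun_le. Qed.

(** On these indicators the limit is explicit; as their span is dense, this formula determines the
    embedding. *)
Lemma L1_embedding_itv (k : int) (a b : R) :
    k%:~R <= a -> a <= b -> b <= (k + 1)%:~R ->
  L1_embedding (Lclass mu \1_(`]a, b]%classic)) =
  delta (cone_path u v k b) - delta (cone_path u v k a).
Proof.
move=> ka ab bk; apply/val_inj/funext => f /=.
change (embed_fun (Lclass mu \1_(`]a, b]%classic)) f =
  f (cone_path u v k b) - f (cone_path u v k a)).
by apply: cvg_lim => //; exact: cvg_path_quotient_itv.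
Qed.

Let continuous_L1_embedding : continuous L1_embedding.
Proof.
apply: (@dist_le_continuous _ _ _ _ `|v|) => w1 w2.
by rewrite -linearB; exact: L1_embedding_le.
Qed.

(** Indicators go to differences of evaluations, and the preimage of the closed subspace F^ph under
    a continuous linear map is a closed subspace. *)
Lemma L1_embedding_Fph w : Fph X (L1_embedding w).
Proof.
have linF : is_linear_subspace (Fph X).
  exact/closure_linear_subspace/linspan_linear_subspace.
apply: (@interval_indicators_total _ [set w | Fph X (L1_embedding w)]).
- split=> [|a w1 w2 /= F1 F2]; first by rewrite /= linear0; exact: linF.1.
  by rewrite linearP; exact: linF.2.
- apply: preimage_closed; last exact: closed_closure.
  by move=> x _; exact: continuous_L1_embedding.
- move=> k a b ka ab bk /=; rewrite (L1_embedding_itv ka ab bk).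
  rewrite addrC -scaleN1r; apply: linF.2; apply: subset_closure.
    by apply: linspan_mem; exists (cone_path u v k a).
  by apply: linspan_mem; exists (cone_path u v k b).
Qed.

(** Both sides are linear and continuous in [w] and agree on interval indicators, so the zero set of
    their difference [D] is everything. *)
Lemma L1_embedding_density (f : Lip0ph X) (sigma : R -> R) w :
    measurable_fun (setT : set (measurableTypeR R)) sigma ->
    (forall x, `|sigma x| <= 1) ->
    (forall (k : int) (a b : R), k%:~R <= a -> a <= b -> b <= (k + 1)%:~R ->
      f (cone_path u v k b) - f (cone_path u v k a) = \int[mu]_(x in `]a, b])
        sigma x) ->
  L1_embedding w f = @L1_pair _ _ _ mu sigma w.
Proof.
move=> msig sig1 fP; apply/eqP; rewrite -subr_eq0; apply/eqP.
pose D w := L1_embedding w f - @L1_pair _ _ _ mu sigma w.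
have D_linear a w1 w2 : D (a *: w1 + w2) = a * D w1 + D w2.
  have E : L1_embedding (a *: w1 + w2)
    f = a * L1_embedding w1 f + L1_embedding w2 f.
    by rewrite linearP.
  by rewrite /D (L1_pair_linear msig sig1) E; ring.
apply: (@interval_indicators_total _ [set w | D w = 0]).
- split=> [|a w1 w2 /= D1 D2]; last by rewrite D_linear D1 D2 mulr0 addr0.
  by have := D_linear (-1) 0 0; rewrite scaler0 addr0 mulN1r addNr.
- apply: (@preimage_closed (L1 mu) R D [set 0]); last exact: closed_eq.
  move=> x _; apply: (@dist_le_continuous _ (L1 mu) R _ (`|v| * `|f| + 1))
    => w1 w2.
  rewrite addrC -mulN1r -D_linear scaleN1r addrC /D.
  rewrite (le_trans (ler_normB _ _))// mulrDl lerD//; last exact: L1_pair_le.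
  rewrite (le_trans (dual_normP _ _))// mulrAC ler_wpM2r ?lip_norm_ge0//.
  exact: L1_embedding_le.
- move=> k a b ka ab bk /=.
  have E : L1_embedding (Lclass mu \1_(`]a, b]%classic)) f =
      f (cone_path u v k b) - f (cone_path u v k a).
    by rewrite (L1_embedding_itv ka ab bk).
  rewrite /D E (fP k a b ka ab bk).
  rewrite (L1_pair_class msig sig1); last exact: integrable_indic_itv.
  rewrite Rintegral_mkcond; apply/eqP; rewrite subr_eq0; apply/eqP.
  apply: eq_Rintegral => x _; rewrite patchE indicE.
  by case: ifPn; rewrite ?mul1r ?mul0r.
Qed.

(** Duality: the functional is tested on a function of norm at most 12 / c whose density is the sign
    of [w], and its value there is the norm of [w]. *)
Lemma L1_embedding_ge (c : R) : 0 < c ->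
    (forall a b : R, c * (`|a| + `|b|) <= `|a *: u + b *: v|) ->
  forall w, `|w| <= 12 / c * `|L1_embedding w|.
Proof.
move=> c0 uvP w.
(* The sign is set to 1 where [w] vanishes, so that [w] times [sigma] is |w| at every point. *)
pose sigma (x : R) : R := if 0 <= L1_repr w x then 1 else -1.
have msig : measurable_fun (setT : set (measurableTypeR R)) sigma.
  by apply: measurable_fun_if => //; apply: measurable_fun_ler.
have sig1 x : `|sigma x| <= 1 by rewrite /sigma; case: ifP => _;
  rewrite ?normrN normr1.
have [f fc fP] := Lip0ph_of_density c0 uvP msig sig1.
have <- : L1_embedding w f = `|w|.
  rewrite (L1_embedding_density w msig sig1 fP) norm_L1.
  apply: eq_Rintegral => x _; rewrite /sigma.
  case: ifPn => [w0|]; first by rewrite mulr1 ger0_norm.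
  by rewrite -ltNge mulrN1 => /ltr0_norm.
rewrite (le_trans (ler_norm _))// (le_trans (dual_normP _ _))// mulrC.
by rewrite ler_wpM2r ?dual_norm_ge0.
Qed.

End embedding.

(** * Infinite dimension of the function space and conclusion *)

Lemma Lip0ph_infinite_dimensional (R : realType) (X : normedModType R)
    (u v : X) (c : R) : 0 < c ->
    (forall a b : R, c * (`|a| + `|b|) <= `|a *: u + b *: v|) ->
  ~ finite_dimensional (Lip0ph X).
Proof.
move=> c0 uvP [n [g gP]].
(* A function with this density increases by 1 across cell [j] and by 0 across every other cell,
   which gives a biorthogonal system. *)
pose sigma (j : nat) : R -> R := \1_(`]j%:R, j.+1%:R]%classic).
have /choice[f fP] : forall j, exists f : Lip0ph X,
    forall k : nat, f (cone_path u v k k.+1%:R) - f (cone_path u v k k%:R)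
      = (j == k)%:R.
  move=> j.
  have [||f _ fP] := @Lip0ph_of_density _ _ u v c (sigma j) c0 uvP.
  - exact: measurable_indic.
  - by move=> x; rewrite /sigma indicE normr_nat lern1 leq_b1.
  exists f => k; rewrite fP//; last 2 first.
  - by rewrite ler_nat.
  - by rewrite intrD natr1.
  have [<-|jk] := eqVneq j k.
    rewrite (@eq_Rintegral _ _ _ _ _ (fun=> 1)); last first.
      by move=> x xj; rewrite /sigma indicE xj.
    rewrite Rintegral_cst//= lebesgue_measure_itv/= lte_fin ltr_nat ltnSn
      -EFinB /=.
    by rewrite -natr1 mul1r addrC addKr.
  rewrite (@eq_Rintegral _ _ _ _ _ (fun=> 0)) ?Rintegral_cst ?mul0r// => x.
  rewrite inE/= in_itv/= => /andP[kx xk]; rewrite /sigma indicE memNset//=.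
  rewrite in_itv/= => /andP[jx xj]; move/eqP : jk; apply; apply/eqP.
  rewrite eqn_leq -ltnS -(ltr_nat R) (lt_le_trans jx xk)/=.
  by rewrite -ltnS -(ltr_nat R) (lt_le_trans kx xj).
have /choice[a aP] : forall j, exists a : 'I_n -> R, f j = \sum_i a i *: g i.
  by move=> j; exact: gP.
pose A := \matrix_(j < n.+1, i < n) a j i.
pose B := \matrix_(i < n, k < n.+1)
  (g i (cone_path u v k k.+1%:R) - g i (cone_path u v k k%:R)).
(* Expanding n + 1 of these functions over [n] generators would factor the identity matrix of size n
   + 1 through dimension [n]. *)
suff /mulmx1_min : A *m B = 1%:M by rewrite ltnn.
apply/matrixP => j k; rewrite !mxE.
have -> : (j == k)%:R = f j (cone_path u v k k.+1%:R)
  - f j (cone_path u v k k%:R).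
  by rewrite fP.
rewrite aP.
have E x : (\sum_i a j i *: g i : Lip0ph X) x = \sum_i a j i * g i x.
  exact: (big_morph (fun h : Lip0ph X => h x) (fun _ _ => erefl) erefl).
rewrite !E -sumrB; apply: eq_bigr => i _.
by rewrite !mxE mulrBr.
Qed.

Theorem proposition4p2 (R : realType) (X : completeNormedModType R)
    (hX : dim_ge X 2) :
  (exists Y : set (dual (Lip0ph X)),
    [/\ Y `<=` Fph X, is_linear_subspace Y, closed Y
      & linearly_isomorphic_to_subspace (L1 (@lebesgue_measure R)) Y])
  /\ ~ finite_dimensional (Lip0ph X).
Proof.
have [e /lin_indep2_norm_ge[c c0 eP]] := hX.
split; last exact: Lip0ph_infinite_dimensional c0 eP.
pose T := L1_embedding (e ord0) (e ord_max).
have TM := L1_embedding_le (e ord0) (e ord_max).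
have TK := L1_embedding_ge c0 eP.
exists (range T); split.
- by move=> _ [w _ <-]; exact: L1_embedding_Fph.
- split=> [|a _ _ [w1 _ <-] [w2 _ <-]]; first by exists 0; rewrite ?linear0.
  by exists (a *: w1 + w2); rewrite ?linearP.
(* Completeness of L^1 and the lower bound make the range closed. *)
- exact: (closed_range_bounded_below (@L1_cvg_series _ _ _ _) TM TK).
- exact: linearly_isomorphic_bounded_below TM TK.
Qed.
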